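(* Let $G=(V,E,F)$ be a closed 2-cell embedding in a closed surface $\Sigma$. Let $\Theta(e)\in(0,\frac{\pi}{2})$, $e\in E$, be intersection angles, and let $\hat L_v>0$ for $v\in V$. Consider the prescribed geodesic curvature flow $$\frac{\mathrm{d} r_v}{\mathrm{d}t}=\frac{L_v-\hat L_v}{2}\,\sin(2r_v),\qquad v\in V,$$ for $r(t)=(r_v(t))_{v\in V}\in(0,\frac{\pi}{2})^V$, where $L_v=L_v(r(t))$ is the total geodesic curvature of the circle $C_v$. The following are equivalent: (i) The flow with $\{\hat L_v\}_{v\in V}$ converges for any initial data $r(0)\in(0,\frac{\pi}{2})^V$. (ii) For every nonempty subset $X\subseteq V$, $$\sum_{v\in X}\hat L_v<2\sum_{e\in E(X)}\Theta(e).$$ Moreover, if the flow converges, then it converges exponentially fast to a unique circle pattern with $L_v=\hat L_v$ for each vertex $v$; that is, if a solution $r(t)$ of the flow converges, then there is exactly one $r^*\in(0,\frac{\pi}{2})^V$ with $L_v(r^* )=\hat L_v$ for all $v\in V$, and there are constants $C,c>0$ such that $|r(t)-r^*|\le Ce^{-ct}$ for all $t\ge 0$.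
   Context: Graph embeddings. $(V,E)$ is a finite graph, $\Sigma$ a closed surface, and $\eta:V\cup E\to\Sigma$ a graph embedding; vertices and edges are identified with their images. A face is a connected component of $\Sigma\setminus\eta(V\cup E)$, and $F$ is the set of faces. The embedding is a closed 2-cell embedding if the closure of every face is homeomorphic to a closed disk and every face is bounded by a simple closed curve consisting of finitely many edges. For $X\subseteq V$, $E(X)$ denotes the set of edges incident to some vertex in $X$. An edge with endpoints $u,w$ is written $e=\{u,w\}$, and $v<e$ means that the vertex $v$ is incident to the edge $e$. Incidence graph. Put an auxiliary vertex $v_f$ in the interior of each face $f$. The incidence graph $I(G)$ is the bipartite graph with parts $V$ and $V_F=\{v_f: f\in F\}$, where $v\in V$ and $v_f$ are adjacent iff $v$ is on the boundary of $f$. It induces a closed 2-cell embedding with quadrilateral faces, and each $e\in E$ is contained in a unique such quadrilateral. Spherical metric and circle pattern. Given radii $r=(r_v)_{v\in V}\in(0,\frac{\pi}{2})^V$ and intersection angles $\Theta(e)$, for each edge $e=\{u,w\}$ give the associated quadrilateral $uAwB$ (with $A,B\in V_F$) the metric of a spherical quadrilateral (on the unit sphere) with $|uA|=|uB|=r_u$, $|wA|=|wB|=r_w$ and $\angle uAw=\angle uBw=\pi-\Theta(e)$ (a ''spherical bigon''; it is the union of two congruent spherical triangles $uAw$ and $uBw$ along the side $uw$). Its angle at $u$ is $2\beta_{u,e}$, where $\beta_{u,e}\in(0,\pi)$ is the angle at $u$ in the spherical triangle $uAw$ with side lengths $|uA|=r_u$, $|wA|=r_w$ and angle $\pi-\Theta(e)$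 at $A$. Gluing these quadrilaterals along the common edges of $I(G)$ gives a piecewise spherical metric $S(\Sigma)$ with possible conic singularities at $V\cup V_F$. The circle $C_v$ with center $v$ and radius $r_v$ in $S(\Sigma)$, for $v\in V$, form the circle pattern determined by $r$. Total geodesic curvature. The cone angle at $v\in V$ is $\alpha_v=\sum_{e: v<e}2\beta_{v,e}$. The circle $C_v$ has geodesic curvature $k_v=\cot r_v$ and length $l_v=\alpha_v\sin r_v$, and its total geodesic curvature is $L_v=l_vk_v=\alpha_v\cos r_v$, a function of $r$. Convergence. The flow converges (for given initial data) if there is $r_v^*\in(0,\frac{\pi}{2})$ for each $v\in V$ such that $r_v(t)\to r_v^*$ as $t\to\infty$. *)

(* Defs.v *)
From HB Require Import structures.
From mathcomp Require Import all_boot all_order all_algebra.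
From mathcomp Require Import all_classical all_reals all_analysis.
From mathcomp Require Import ring lra.

Set Implicit Arguments.
Unset Strict Implicit.
Unset Printing Implicit Defensive.

Import Order.TTheory GRing.Theory Num.Theory.
Import numFieldNormedType.Exports.

Local Open Scope classical_set_scope.
Local Open Scope ring_scope.

Definition homeomorphic (S T : topologicalType) (A : set S) (B : set T) : Prop :=
  exists (f : S -> T) (g : T -> S),
    [/\ {within A, continuous f} /\ {within B, continuous g},
        f @` A = B, g @` B = A,
        {in A, cancel f g} & {in B, cancel g f}].

Definition open_disk (R : realType) : set (R * R) :=
  [set p | p.1 ^+ 2 + p.2 ^+ 2 < 1].
Definition closed_disk (R : realType) : set (R * R) :=
  [set p | p.1 ^+ 2 + p.2 ^+ 2 <= 1].
Definition unit_circle (R : realType) : set (R * R) :=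
  [set p | p.1 ^+ 2 + p.2 ^+ 2 = 1].

(* Second countability follows from compactness and the charts. *)
Record closed_surface (R : realType) (S : topologicalType) : Prop := {
  surface_nonempty : [set: S] !=set0;
  surface_hausdorff : hausdorff_space S;
  surface_compact : compact [set: S];
  surface_connected : connected [set: S];
  surface_chart : forall x : S, exists U : set S,
    [/\ open U, U x & homeomorphic U (@open_disk R)]
}.

(* Edges are abstract (parallel edges are allowed) and have two distinct
   endpoints; [ends e] is the set {u, w} of endpoints of e. *)
Definition two_ended (V E : finType) (ends : E -> {set V}) : Prop :=
  forall e, #|ends e| = 2%N.

(* The edge e is carried by the arc t |-> edge_curve e t, 0 <= t <= 1. *)
Record graph_embedding (R : realType) (S : topologicalType) (V E : finType)
    (ends : E -> {set V}) := GraphEmbedding {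
  vertex_point : V -> S;
  edge_curve : E -> R -> S;
  vertex_point_inj : injective vertex_point;
  edge_curve_continuous : forall e, {within `[0, 1], continuous (edge_curve e)};
  edge_curve_inj : forall e, {in `[0, 1] &, injective (edge_curve e)};
  edge_curve_ends : forall e,
    [set edge_curve e 0; edge_curve e 1] = vertex_point @` [set` ends e];
  edge_curve_vertex : forall e t v,
    t \in `]0, 1[ -> edge_curve e t <> vertex_point v;
  edge_curve_disjoint : forall e e' s t,
    s \in `]0, 1[ -> t \in `]0, 1[ -> edge_curve e s = edge_curve e' t -> e = e'
}.

Section Embedding.
Context {R : realType} {S : topologicalType} {V E : finType}.
Context {ends : E -> {set V}} (eta : graph_embedding R S ends).

Definition edge_image (e : E) : set S := edge_curve eta e @` `[0, 1].

Definition graph_image : set S :=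
  range (vertex_point eta) `|` \bigcup_e edge_image e.

Definition face (f : set S) : Prop :=
  exists2 x, (~` graph_image) x & f = connected_component (~` graph_image) x.

Definition closed_2cell_embedding : Prop :=
  forall f, face f ->
    homeomorphic (closure f) (@closed_disk R) /\
    homeomorphic (closure f `\` interior f) (@unit_circle R) /\
    exists D : {set E},
      closure f `\` interior f = \bigcup_(e in [set` D]) edge_image e.

End Embedding.

Section Sphere.
Context {R : realType}.
Implicit Types p q s : 'rV[R]_3.

Definition dot p q : R := \sum_i p 0 i * q 0 i.

Definition on_sphere p : Prop := dot p p = 1.

Definition sphere_dist p q : R := acos (dot p q).

(* Orthogonal projection of q on the tangent plane at p: a tangent vector at p
   pointing along the great-circle arc from p to q. *)
Definition tangent_toward p q : 'rV[R]_3 := q - dot p q *: p.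

Definition sphere_angle p q s : R :=
  let x := tangent_toward p q in
  let y := tangent_toward p s in
  acos (dot x y / (Num.sqrt (dot x x) * Num.sqrt (dot y y))).

Definition polar_point (r phi : R) : 'rV[R]_3 :=
  \row_(i < 3) [:: sin r * cos phi; sin r * sin phi; cos r]`_i.

(* The angle at u in the spherical triangle u A w with |uA| = ru, |wA| = rw and
   angle a at A, here placed with A at the north pole. *)
Definition triangle_angle (ru rw a : R) : R :=
  sphere_angle (polar_point ru 0) (polar_point 0 0) (polar_point rw a).

Lemma dotC p q : dot p q = dot q p.
Proof. by apply: eq_bigr => i _; rewrite mulrC. Qed.

Lemma dot_tangent p q s : on_sphere p ->
  dot (tangent_toward p q) (tangent_toward p s) = dot q s - dot p q * dot p s.
Proof.
have dB x y z : dot (x - dot p y *: p) z = dot x z - dot p y * dot p z.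
  rewrite /dot mulr_sumr -sumrB; apply: eq_bigr => i _; rewrite !mxE.
  by rewrite mulrBl mulrA.
rewrite /on_sphere /tangent_toward => pp.
rewrite dB 2!(dotC _ (s - _)) !dB pp (dotC s q) (dotC s p).
by rewrite mulr1 subrr mulr0 subr0 mulrC.
Qed.

Lemma dot_CS p q : dot p q ^+ 2 <= dot p p * dot q q.
Proof.
rewrite -subr_ge0 /dot !big_ord_recl !big_ord0 !addr0.
set a := p _ _; set b := p _ _; set c := p _ _.
set x := q _ _; set y := q _ _; set z := q _ _.
have -> : (a * a + (b * b + c * c)) * (x * x + (y * y + z * z)) -
  (a * x + (b * y + c * z)) ^+ 2 =
  (a * y - b * x) ^+ 2 + (a * z - c * x) ^+ 2 + (b * z - c * y) ^+ 2 by ring.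
by rewrite !addr_ge0 ?sqr_ge0.
Qed.

Lemma polar_point_on_sphere (r phi : R) : on_sphere (polar_point r phi).
Proof.
have h1 := cos2Dsin2 r; have h2 := cos2Dsin2 phi.
rewrite /on_sphere /dot !big_ord_recl !big_ord0 !mxE /= addr0.
nra.
Qed.

Lemma sphere_angleE p q s : on_sphere p -> on_sphere q -> on_sphere s ->
  sphere_angle p q s = acos ((dot q s - dot p q * dot p s) /
    (Num.sqrt (1 - dot p q ^+ 2) * Num.sqrt (1 - dot p s ^+ 2))).
Proof.
by move=> hp hq hs; rewrite /sphere_angle !dot_tangent// hq hs !expr2.
Qed.

Lemma sphere_angle_triangle u A w (ru rw a : R) :
  on_sphere u -> on_sphere A -> on_sphere w ->
  0 < ru < pi -> 0 < rw < pi ->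
  sphere_dist A u = ru -> sphere_dist A w = rw -> sphere_angle A u w = a ->
  sphere_angle u A w = triangle_angle ru rw a.
Proof.
move=> hu hA hw /andP[ru0 rupi] /andP[rw0 rwpi].
have dot1 p q : on_sphere p -> on_sphere q -> -1 <= dot p q <= 1.
  move=> hp hq; have := dot_CS p q; rewrite hp hq mulr1 => h.
  by rewrite -ler_norml -(@ler_pXn2r _ 2) ?nnegrE// expr1n real_normK// num_real.
have dist p q (x : R) : on_sphere p -> on_sphere q -> sphere_dist p q = x ->
    dot p q = cos x.
  by move=> hp hq <-; rewrite acosK// in_itv /= dot1.
move=> /(dist _ _ _ hA hu) Au /(dist _ _ _ hA hw) Aw.
have sinp (x : R) : 0 < x -> x < pi -> 0 < sin x.
  by move=> x0 xpi; apply: sin_gt0_pi; rewrite x0.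
have sqE (x : R) : 0 < x -> x < pi -> Num.sqrt (1 - cos x ^+ 2) = sin x.
  by move=> x0 xpi; rewrite -sin2cos2 sqrtr_sqr gtr0_norm ?sinp.
have su := sinp _ ru0 rupi; have sw := sinp _ rw0 rwpi.
rewrite sphere_angleE// Au Aw !sqE// => aE.
have uw : dot u w = cos ru * cos rw + sin ru * sin rw * cos a.
  rewrite -aE acosK; first by field; rewrite !gt_eqF.
  have := dot_CS (tangent_toward A u) (tangent_toward A w).
  rewrite !dot_tangent// hu hw Au Aw -!expr2 -!sin2cos2 -exprMn => h.
  have ss := mulr_gt0 su sw.
  rewrite in_itv /= -ler_norml normrM normfV (gtr0_norm ss) ler_pdivrMr//.
  rewrite mul1r -ler_sqr ?nnegrE ?normr_ge0 ?(ltW ss)//.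
  by rewrite real_normK ?num_real.
rewrite /triangle_angle !sphere_angleE//; try exact: polar_point_on_sphere.
congr (acos ((_ - _ * _) / (Num.sqrt (1 - _ ^+ 2) * Num.sqrt (1 - _ ^+ 2)))).
all: rewrite ?uw ?(dotC u) ?Au ?Aw /dot !big_ord_recl !big_ord0 !mxE /=.
all: rewrite ?sin0 ?cos0; ring.
Qed.

End Sphere.

Section CirclePattern.
Context {R : realType} {V E : finType}.
Variables (ends : E -> {set V}) (Theta : E -> R).
Implicit Types (r : {ffun V -> R}) (v : V) (e : E) (X : {set V}).

Definition incident_edges X : {set E} :=
  [set e | [exists v in X, v \in ends e]].

Definition other_end v e : V := odflt v [pick w in ends e :\ v].

Definition beta r v e : R :=
  triangle_angle (r v) (r (other_end v e)) (pi - Theta e).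

Definition cone_angle r v : R := \sum_(e | v \in ends e) 2 * beta r v e.

Definition geodesic_curvature r v : R := cos (r v) / sin (r v).

Definition circle_length r v : R := cone_angle r v * sin (r v).

Definition total_geodesic_curvature r v : R :=
  circle_length r v * geodesic_curvature r v.

Definition admissible_radii r : Prop := forall v, 0 < r v < pi / 2.

Variable Lhat : V -> R.

(* The derivative is taken within [0, +oo[, hence one-sided at t = 0. *)
Definition flow_solution (rt : R -> {ffun V -> R}) : Prop :=
  forall t, 0 <= t -> admissible_radii (rt t) /\
    forall v,
      h^-1 * (rt (t + h) v - rt t v) @[h --> within [set h | 0 <= t + h] 0^']
      --> (total_geodesic_curvature (rt t) v - Lhat v) / 2 * sin (2 * rt t v).

Definition radii_converge (rt : R -> {ffun V -> R}) : Prop :=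
  exists rs : {ffun V -> R},
    admissible_radii rs /\ forall v, rt t v @[t --> +oo] --> rs v.

Definition flow_converges_from (r0 : {ffun V -> R}) : Prop :=
  (exists2 rt, flow_solution rt & rt 0 = r0) /\
  (forall rt, flow_solution rt -> rt 0 = r0 -> radii_converge rt).

Definition radii_dist (r s : {ffun V -> R}) : R :=
  Num.sqrt (\sum_v (r v - s v) ^+ 2).

End CirclePattern.

(* Main.v *)
Require Import Defs.
From HB Require Import structures.
From mathcomp Require Import all_boot all_order all_algebra.
From mathcomp Require Import all_classical all_reals all_analysis.
From mathcomp Require Import ring lra.

Set Implicit Arguments.
Unset Strict Implicit.
Unset Printing Implicit Defensive.

Import Order.TTheory GRing.Theory Num.Theory.
Import numFieldNormedType.Exports.

Local Open Scope classical_set_scope.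
Local Open Scope ring_scope.

(** Write [k_v = ln (cot r_v)] for the logarithm of the geodesic curvature of the
    circle at [v]. The flow becomes [dk_v/dt = Lhat_v - L_v(k)] on the whole space
    of real vectors, and its stationary points are the patterns sought.

    The contribution of an edge [e = {u, w}] to [L_u] is twice the weight
    [x * acot (x * y)] ([edge_weight], [triangle_angleE]), where [x = cos r_u]
    depends on [k_u] only and [acot y] is the angle at [u] of the Euclidean
    triangle with the same angle at the third vertex and ratio of sides
    [exp (k_w - k_u)]. Hence the weight
    - decreases when [k_w] increases ([edge_weight_decr]),
    - strictly increases when the same amount is added to [k_u] and [k_w], as [y]
      is unchanged and the slope [acot z - z / (1 + z ^ 2)] is positive
      ([acot_slope_gt0], [edge_weight_shift]),
    - is smaller than the Euclidean angle, but close to it for small radii; and the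
      two Euclidean angles of [e] add up to [Theta e] ([euclidean_angle_sum]).

    Necessity of the inequalities is the last property, summed over the edges
    incident to [X] at a stationary point ([sum_curv_lt]); the limit of a convergent
    solution is stationary ([limit_critical]).

    For sufficiency a stationary point is obtained by Perron's method. By the first
    property, subsolutions ([L_v <= Lhat_v] for all [v]) are stable under maxima. If
    they were unbounded on a set [X] of vertices, the third property would give
    [sum_(v in X) Lhat_v >= 2 sum_(e in E(X)) Theta e] in the limit
    ([subsolution_bounded]). So their supremum is finite, and it is stationary
    ([critical_exists]).

    Convergence to a stationary point [k*] is a maximum principle. Where
    [|k_v - k*_v|] attains its maximum [m] over [v], the first property compares
    [L_v(k)] with [L_v(k* + m)] or [L_v(k* - m)], and the second shows that the
    velocity points towards [k*] with size at least a multiple of [m]. Thus the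
    maximum decays exponentially ([exponential_convergence], from [first_exit]),
    which also gives uniqueness. Solutions exist for all time because the vector
    field is bounded and globally Lipschitz ([global_solution]). *)

(** * Derivatives and elementary estimates *)

Section MeanValue.
Context {R : realType}.
Implicit Types f g df dg : R -> R.

Lemma is_derive_continuous f (x d : R) :
  is_derive x 1 f d -> {for x, continuous f}.
Proof.
by move=> [h _]; apply: differentiable_continuous; exact/derivable1_diffP.
Qed.

Lemma is_derive_add f g (x a b : R) : is_derive x 1 f a -> is_derive x 1 g b ->
  is_derive x 1 (fun y => f y + g y) (a + b).
Proof. by move=> ? ?; exact: is_deriveD. Qed.

Lemma is_derive_sub f g (x a b : R) : is_derive x 1 f a -> is_derive x 1 g b ->
  is_derive x 1 (fun y => f y - g y) (a - b).
Proof. by move=> ? ?; exact: is_deriveB. Qed.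

Lemma is_derive_opp f (x a : R) : is_derive x 1 f a ->
  is_derive x 1 (fun y => - f y) (- a).
Proof. by move=> ?; exact: is_deriveN. Qed.

Lemma is_derive_mul f g (x a b : R) : is_derive x 1 f a -> is_derive x 1 g b ->
  is_derive x 1 (fun y => f y * g y) (f x * b + g x * a).
Proof. by move=> ? ?; exact: is_deriveM. Qed.

Lemma is_derive_scale f (k x a : R) : is_derive x 1 f a ->
  is_derive x 1 (fun y => k * f y) (k * a).
Proof. by move=> ?; exact: is_deriveZ. Qed.

Lemma is_derive_linear (k x : R) : is_derive x 1 (fun y : R => k * y) k.
Proof. by rewrite -[X in is_derive _ _ _ X]mulr1; exact: is_derive_scale. Qed.

Lemma is_derive_inv f (x a : R) : f x != 0 -> is_derive x 1 f a ->
  is_derive x 1 (fun y => (f y)^-1) (- a / f x ^+ 2).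
Proof.
move=> fx0 ?; rewrite mulNr mulrC -mulNr; exact: is_deriveV.
Qed.

Lemma mean_value f df (a b : R) : a <= b ->
  (forall x, a <= x <= b -> is_derive x 1 f (df x)) ->
  exists2 c, a <= c <= b & f b - f a = df c * (b - a).
Proof.
move=> ab hf.
have sub x : x \in `]a, b[ -> is_derive x 1 f (df x).
  by rewrite in_itv /= => /andP[/ltW ax /ltW xb]; apply: hf; rewrite ax.
have cf : {within `[a, b], continuous f}.
  by apply: derivable_within_continuous => x; rewrite in_itv /= => /hf[].
have [c cab ->] := MVT_segment ab sub cf.
by exists c => //; move: cab; rewrite in_itv.
Qed.

Lemma le_increment f g df dg (a b : R) : a <= b ->
  (forall x, a <= x <= b -> is_derive x 1 f (df x)) ->
  (forall x, a <= x <= b -> is_derive x 1 g (dg x)) ->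
  (forall x, a <= x <= b -> df x <= dg x) ->
  f b - f a <= g b - g a.
Proof.
move=> ab hf hg fg.
have hfg x : a <= x <= b -> is_derive x 1 (fun y => g y - f y) (dg x - df x).
  by move=> hx; apply: is_derive_sub; [exact: hg|exact: hf].
have [c /fg cab e] := mean_value ab hfg.
have : 0 <= (dg c - df c) * (b - a) by rewrite mulr_ge0 ?subr_ge0.
rewrite -e; lra.
Qed.

Lemma le_increment_slope f df (a b m : R) : a <= b ->
  (forall x, a <= x <= b -> is_derive x 1 f (df x)) ->
  (forall x, a <= x <= b -> m <= df x) ->
  m * (b - a) <= f b - f a.
Proof.
move=> ab hf fm; have := le_increment (f := *%R m) (df := cst m) ab _ hf fm.
by rewrite mulrBr; apply=> x _; exact: is_derive_linear.
Qed.

Lemma normr_increment_le f df (a b m : R) : a <= b ->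
  (forall x, a <= x <= b -> is_derive x 1 f (df x)) ->
  (forall x, a <= x <= b -> `|df x| <= m) ->
  `|f b - f a| <= m * (b - a).
Proof.
move=> ab hf fm; rewrite ler_norml -mulNr; apply/andP; split.
  apply: (le_increment_slope ab hf) => x /fm; rewrite ler_norml => /andP[]//.
have hN x : a <= x <= b -> is_derive x 1 (fun y => - f y) (- df x).
  by move=> /hf; exact: is_derive_opp.
have fm' x : a <= x <= b -> - m <= - df x.
  by move=> /fm; rewrite ler_norml lerN2 => /andP[].
by have := le_increment_slope ab hN fm'; lra.
Qed.

End MeanValue.

Section Estimates.
Context {R : realType}.
Implicit Types c : R.

Lemma finite_uniform_gt0 (I : finType) (f : I -> R) : (forall i, 0 < f i) ->
  exists2 m, 0 < m & forall i, m <= f i.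
Proof.
move=> f0; have S0 : 0 <= \sum_i (f i)^-1.
  by apply: sumr_ge0 => i _; rewrite invr_ge0 ltW.
exists (1 + \sum_i (f i)^-1)^-1; first by rewrite invr_gt0 ltr_wpDr.
move=> i; rewrite -[leRHS]invrK lef_pV2 ?posrE ?invr_gt0 ?ltr_wpDr//.
rewrite (bigD1 i)//= addrCA lerDl addr_ge0//.
by apply: sumr_ge0 => j _; rewrite invr_ge0 ltW.
Qed.

Lemma ler_sum_card (I : finType) (P : pred I) (f : I -> R) c : 0 <= c ->
  (forall i, P i -> f i <= c) -> \sum_(i | P i) f i <= #|I|%:R * c.
Proof.
move=> c0 fc; apply: (@le_trans _ _ (\sum_(i | P i) c)); first exact: ler_sum.
rewrite sumr_const -[_ *+ _]mulr_natl ler_wpM2r// ler_nat; exact: max_card.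
Qed.

Lemma expR_small (C c e : R) : 0 < C -> 0 < c -> 0 < e ->
  exists2 T, 0 <= T & forall t, T <= t -> C * expR (- (c * t)) < e.
Proof.
move=> C0 c0 e0; exists (C / e / c); first by rewrite !divr_ge0// ltW.
move=> t Tt; rewrite expRN ltr_pdivrMr ?expR_gt0// mulrC -ltr_pdivrMr//.
apply: lt_le_trans (expR_ge1Dx _).
by move: Tt; rewrite ler_pdivrMr// mulrC; lra.
Qed.

End Estimates.

(** * Arccotangent and Euclidean triangles *)

Section Arccotangent.
Context {R : realType}.
Implicit Types (a b d m th x y z : R).

Definition acot z : R := pi / 2 - atan z.

Lemma acot_gt0 z : 0 < acot z.
Proof. by rewrite subr_gt0 atan_ltpi2. Qed.

Lemma acot_lt z z' : z < z' -> acot z' < acot z.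
Proof. by move=> /lt_atan zz'; rewrite /acot ltrD2l ltrN2. Qed.

Lemma acot_le z z' : z <= z' -> acot z' <= acot z.
Proof. by move=> /le_atan zz'; rewrite /acot lerD2l lerN2. Qed.

Lemma acot_le_pihalf z : 0 <= z -> acot z <= pi / 2.
Proof. by move=> /le_atan; rewrite atan0 /acot; lra. Qed.

Lemma continuous_acot : continuous acot.
Proof.
by move=> z; apply: cvgB; [exact: cvg_cst|exact: continuous_atan].
Qed.

Lemma is_derive_acot z : is_derive z 1 acot (- (1 + z ^+ 2)^-1).
Proof.
by rewrite -[X in is_derive _ _ _ X]sub0r; exact: is_derive_sub.
Qed.

Lemma acot_unique a z : 0 < a < pi -> cos a = z * sin a -> acot z = a.
Proof.
move=> api ca; have sa := sin_gt0_pi api; move: api => /andP[a0 api].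
have -> : z = tan (pi / 2 - a).
  rewrite /tan cosB sinB cos_pihalf sin_pihalf !mul0r !mul1r subr0 add0r.
  by rewrite ca mulfK ?gt_eqF.
by rewrite /acot tanK ?in_itv /=; lra.
Qed.

Lemma sqr_sqrt_1D z : Num.sqrt (1 + z ^+ 2) ^+ 2 = 1 + z ^+ 2.
Proof. by rewrite sqr_sqrtr// addr_ge0 ?sqr_ge0. Qed.

Lemma sqrt_1D_gt0 z : 0 < Num.sqrt (1 + z ^+ 2).
Proof. by rewrite sqrtr_gt0 ltr_wpDr ?sqr_ge0. Qed.

Lemma sin_acot z : sin (acot z) = (Num.sqrt (1 + z ^+ 2))^-1.
Proof. by rewrite sinB sin_pihalf cos_pihalf mul1r mul0r subr0 cos_atan. Qed.

Lemma cos_acot z : cos (acot z) = z * sin (acot z).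
Proof.
rewrite cosB sinB sin_pihalf cos_pihalf !mul0r !mul1r add0r subr0.
have := atanK z; rewrite /tan => {2}<-; rewrite mulfVK// cos_atan.
by rewrite invr_eq0 gt_eqF ?sqrt_1D_gt0.
Qed.

Lemma acot_lt_pi z : acot z < pi.
Proof. by have := atan_gtNpi2 z; rewrite /acot; lra. Qed.

(** The derivative of [x * acot (x * y)] with respect to [x], at [x * y = z]. *)
Definition acot_slope z : R := acot z - z / (1 + z ^+ 2).

Lemma is_derive_acot_slope z :
  is_derive z 1 acot_slope (- (2 / (1 + z ^+ 2) ^+ 2)).
Proof.
have z0 : 1 + z ^+ 2 != 0 by rewrite gt_eqF// ltr_wpDr ?sqr_ge0.
have d1 : is_derive z 1 (fun y => 1 + y ^+ 2) (2 * z).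
  by apply: is_derive_eq; rewrite /GRing.scale /=; ring.
have d2 := is_derive_mul (is_derive_id z 1)
  (is_derive_inv (f := fun y => 1 + y ^+ 2) z0 d1).
by apply: is_derive_eq (is_derive_sub (is_derive_acot z) d2) _; field.
Qed.

Lemma acot_slope_le z z' : z <= z' -> acot_slope z' <= acot_slope z.
Proof.
move=> zz'; have := le_increment (g := cst 0) (dg := cst 0) zz'
  (fun x _ => is_derive_acot_slope x) (fun x _ => is_derive_cst _ _ _).
rewrite subrr subr_le0; apply=> x _.
by rewrite oppr_le0 divr_ge0// sqr_ge0.
Qed.

(** [acot_slope] decreases, so if it were nonpositive somewhere it would be
    bounded above by some [- e < 0] further on, hence [z / (1 + z ^ 2) >= e]
    for all large [z], which fails at [z > 1 / e]. *)
Lemma acot_slope_gt0 z : 0 < acot_slope z.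
Proof.
rewrite ltNge; apply/negP => h.
have lt0 : acot_slope (z + 1) < 0.
  have z1 : z <= z + 1 by rewrite lerDl.
  have [c _] := mean_value z1 (fun x _ => is_derive_acot_slope x).
  have : 0 < 2 / (1 + c ^+ 2) ^+ 2.
    by rewrite divr_gt0// exprn_gt0// ltr_wpDr ?sqr_ge0.
  have -> : z + 1 - z = 1 by ring.
  rewrite mulr1; lra.
set e := - acot_slope (z + 1); have e0 : 0 < e by rewrite oppr_gt0.
pose w := Num.max (z + 1) (e^-1 + 1).
have w1 : z + 1 <= w by rewrite le_max lexx.
have w2 : e^-1 + 1 <= w by rewrite le_max lexx orbT.
have := acot_slope_le w1; have := acot_gt0 w.
rewrite -(opprK (acot_slope (z + 1))) -/e {1}/acot_slope => ac0 hw.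
have : e <= w / (1 + w ^+ 2) by lra.
have ei0 : 0 < e^-1 by rewrite invr_gt0.
rewrite ler_pdivlMr ?ltr_wpDr ?sqr_ge0//.
have : 1 < e * w by rewrite -ltr_pdivrMl// mulr1; lra.
nra.
Qed.

(** In a Euclidean triangle [u A w] with angle [pi - th] at [A] and
    [|wA| / |uA| = exp (- d)], this is the cotangent of the angle at [u]. *)
Definition euclidean_cot th d : R := (expR d + cos th) / sin th.

Definition acute th : Prop := 0 < th < pi / 2.

Lemma acute_sin th : acute th -> 0 < sin th.
Proof. exact: sin_gt0_pihalf. Qed.

Lemma acute_cos th : acute th -> 0 < cos th.
Proof.
by move=> /andP[? ?]; apply: cos_gt0_pihalf; have := pi_gt0 R; lra.
Qed.

Lemma acot_cot th : acute th -> acot (cos th / sin th) = th.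
Proof.
move=> th0; apply: acot_unique; last by rewrite divfK ?gt_eqF ?acute_sin.
by have := pi_gt0 R; move: th0; rewrite /acute; lra.
Qed.

Lemma euclidean_cot_gt th d : acute th -> cos th / sin th < euclidean_cot th d.
Proof.
move=> /acute_sin ?; rewrite ltr_pM2r ?invr_gt0// ltrDr; exact: expR_gt0.
Qed.

Lemma euclidean_cot_gt0 th d : acute th -> 0 < euclidean_cot th d.
Proof.
move=> h; apply: lt_trans (euclidean_cot_gt d h).
by rewrite divr_gt0 ?acute_sin ?acute_cos.
Qed.

Lemma euclidean_cot_le th d d' : acute th -> d <= d' ->
  euclidean_cot th d <= euclidean_cot th d'.
Proof.
by move=> /acute_sin ? dd'; rewrite ler_pM2r ?invr_gt0// lerD2r ler_expR.
Qed.

Lemma is_derive_euclidean_cot th d :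
  is_derive d 1 (euclidean_cot th) (expR d / sin th).
Proof.
by apply: is_derive_eq; rewrite /GRing.scale /=; ring.
Qed.

Lemma euclidean_angle_lt th d : acute th -> acot (euclidean_cot th d) < th.
Proof.
by move=> h; rewrite -[ltRHS](acot_cot h) acot_lt// euclidean_cot_gt.
Qed.

(** The angle sum of the triangle above: exchanging [u] and [w] changes the
    sign of [d], and the third angle is [pi - th]. *)
Lemma euclidean_angle_sum th d : acute th ->
  acot (euclidean_cot th d) + acot (euclidean_cot th (- d)) = th.
Proof.
move=> h; have s0 := acute_sin h.
have al0 := acot_gt0 (euclidean_cot th d); have alth := euclidean_angle_lt d h.
have cal := cos_acot (euclidean_cot th d).
move: al0 alth cal; set al := acot (euclidean_cot th d) => al0 alth cal.
suff -> : acot (euclidean_cot th (- d)) = th - al by rewrite addrC subrK.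
apply: acot_unique.
  by have := pi_gt0 R; move: h; rewrite /acute; lra.
rewrite cosB sinB cal /euclidean_cot expRN.
have := cos2Dsin2 th; set c := cos th; set s := sin th => c2.
have e0 := expR_gt0 d; set E := expR d in e0 *.
apply/eqP; rewrite -subr_eq0; apply/eqP.
have -> : c * ((E + c) / s * sin al) + s * sin al -
    (E^-1 + c) / s * (s * ((E + c) / s * sin al) - c * sin al) =
    sin al / s * (c ^+ 2 + s ^+ 2 - 1) by field; rewrite !gt_eqF.
by rewrite c2 subrr mulr0.
Qed.

End Arccotangent.

(** * Spherical triangles in logarithmic curvatures *)

Section Radius.
Context {R : realType}.
Implicit Types (a b d m th x y z r : R).

Definition radius a : R := atan (expR (- a)).
Definition log_curvature r : R := - ln (tan r).
Definition cosr a : R := cos (radius a).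

Lemma radius_gt0 a : 0 < radius a.
Proof. by rewrite -(@atan0 R) lt_atan// expR_gt0. Qed.

Lemma radius_lt a : radius a < pi / 2.
Proof. exact: atan_ltpi2. Qed.

Lemma radius_in a : radius a \in `](- (pi / 2)), (pi / 2)[.
Proof.
rewrite in_itv /= radius_lt andbT; have := radius_gt0 a.
by have := pi_gt0 R; lra.
Qed.

Lemma log_curvatureK r : 0 < r < pi / 2 -> radius (log_curvature r) = r.
Proof.
move=> /andP[r0 r1]; rewrite /radius /log_curvature opprK lnK.
  by rewrite tanK// in_itv /= r1 andbT; have := pi_gt0 R; lra.
rewrite posrE divr_gt0 ?sin_gt0_pihalf ?r0 ?cos_gt0_pihalf// r1 andbT.
by have := pi_gt0 R; lra.
Qed.

Lemma cosr_gt0 a : 0 < cosr a.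
Proof. by apply: cos_gt0_pihalf; have := radius_in a; rewrite in_itv. Qed.

Lemma sin_radius a : sin (radius a) = cosr a * expR (- a).
Proof. by rewrite -[X in _ * X]atanK mulrC divfK ?gt_eqF ?cosr_gt0. Qed.

Lemma sin_radius_gt0 a : 0 < sin (radius a).
Proof. by rewrite sin_gt0_pihalf// radius_gt0 radius_lt. Qed.

Lemma cosr_lt1 a : cosr a < 1.
Proof.
have := cos2Dsin2 (radius a); rewrite -/(cosr a).
have := sin_radius_gt0 a; have := cosr_gt0 a; nra.
Qed.

Lemma cosr_le_expR a : cosr a <= expR a.
Proof.
have := sin_le1 (radius a).
by rewrite sin_radius expRN ler_pdivrMr ?expR_gt0// mul1r.
Qed.

Lemma is_derive_radius a :
  is_derive a 1 radius (- (sin (radius a) * cosr a)).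
Proof.
have e : is_derive a 1 (fun a => expR (- a)) (- expR (- a)).
  by apply: is_derive_eq; rewrite /GRing.scale /=; ring.
have := is_derive1_comp (is_derive1_atan _) e.
rewrite mulrN; congr (is_derive _ _ _ (- _)).
have := cos_atan (expR (- a)); rewrite -/(radius a) -/(cosr a) => c.
rewrite -sqr_sqrt_1D -exprVn -c sin_radius; ring.
Qed.

Lemma is_derive_cosr a :
  is_derive a 1 cosr (cosr a * (1 - cosr a ^+ 2)).
Proof.
have := is_derive1_comp (is_derive_cos _) (is_derive_radius a).
by rewrite mulrNN mulrA -expr2 sin2cos2 mulrC.
Qed.

Lemma cosr_le a b : a <= b -> cosr a <= cosr b.
Proof.
move=> ab; have := le_increment (f := cst 0) (df := cst 0) ab
  (fun x _ => is_derive_cst _ _ _) (fun x _ => is_derive_cosr x).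
rewrite subrr subr_ge0; apply=> x _ /=.
have := cosr_lt1 x; have := cosr_gt0 x; nra.
Qed.

Lemma cosr_lipschitz a b : `|cosr a - cosr b| <= `|a - b|.
Proof.
wlog ab : a b / b <= a.
  by move=> h; have [/h//|/ltW/h] := leP b a; rewrite distrC [leRHS]distrC.
have := normr_increment_le (m := 1) ab (fun x _ => is_derive_cosr x).
rewrite mul1r (ger0_norm (x := a - b)) ?subr_ge0//; apply=> x _.
rewrite ler_norml; have := cosr_lt1 x; have := cosr_gt0 x => ? ?.
by apply/andP; split; nra.
Qed.

Lemma radius_lipschitz a b : `|radius a - radius b| <= `|a - b|.
Proof.
wlog ab : a b / b <= a.
  by move=> h; have [/h//|/ltW/h] := leP b a; rewrite distrC [leRHS]distrC.
have := normr_increment_le (m := 1) ab (fun x _ => is_derive_radius x).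
rewrite mul1r (ger0_norm (x := a - b)) ?subr_ge0//; apply=> x _.
have := cosr_lt1 x; have := cosr_gt0 x; have := sin_radius_gt0 x.
have := sin_le1 (radius x) => ? ? ? ?.
by rewrite normrN ler_norml; apply/andP; split; nra.
Qed.

Lemma cosr_cvg1 : cosr x @[x --> +oo] --> (1 : R).
Proof.
have c : {for 0, continuous (fun y : R => cos (atan y))}.
  by apply: continuous_comp; [exact: continuous_atan|exact: continuous_cos].
have : (fun y : R => cos (atan y)) (expR (- x)) @[x --> +oo] --> cos (atan (0:R)).
  exact: (cvg_comp _ _ (@cvgr_expR R) c).
by rewrite atan0 cos0.
Qed.

(** The four-parts formula of spherical trigonometry, written in the
    logarithmic curvatures of the two circles. *)
Lemma triangle_angleE th a b : acute th ->
  triangle_angle (radius a) (radius b) (pi - th) =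
  acot (cosr a * euclidean_cot th (b - a)).
Proof.
move=> hth; have s0 := acute_sin hth; have c0 := acute_cos hth.
rewrite /triangle_angle sphere_angleE; try exact: polar_point_on_sphere.
rewrite /dot !big_ord_recl !big_ord0 !mxE /= sin0 cos0.
rewrite cosB sinB cospi sinpi.
rewrite !(mul0r, mulr0, mul1r, mulr1, addr0, add0r, subr0, mulN1r, mulNr, sub0r, opprK).
set z := _ * euclidean_cot _ _.
have sa := sin_radius_gt0 a; have sb := sin_radius_gt0 b.
have ca := cosr_gt0 a; have cb := cosr_gt0 b.
have c2a := cos2Dsin2 (radius a); have c2b := cos2Dsin2 (radius b).
have c2 := cos2Dsin2 th.
have zE : sin th * sin (radius b) * z =
    cosr b * sin (radius a) + cosr a * cos th * sin (radius b).
  rewrite /z /euclidean_cot expRB !sin_radius !expRN; field.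
  by rewrite !gt_eqF ?expR_gt0.
rewrite -!/(cosr _) in c2a c2b *.
set D := sin (radius a) * (sin (radius b) * - cos th) + cosr a * cosr b.
have DN : D ^+ 2 + (sin th * sin (radius b) * z) ^+ 2 =
    cosr b ^+ 2 + cos th ^+ 2 * sin (radius b) ^+ 2.
  rewrite -[RHS]mul1r -c2a zE /D; ring.
have D2 : 1 - D ^+ 2 = (sin th * sin (radius b)) ^+ 2 * (1 + z ^+ 2).
  have : (cos th ^+ 2 + sin th ^+ 2) * sin (radius b) ^+ 2 =
      1 * sin (radius b) ^+ 2 by rewrite c2.
  by rewrite !exprMn in DN *; lra.
have num : cosr b - cosr a * D = sin (radius a) * (sin th * sin (radius b) * z).
  rewrite zE -[cosr b in LHS]mul1r -c2a /D; ring.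
rewrite D2 num sqrtrM ?sqr_ge0// sqrtr_sqr -sin2cos2 sqrtr_sqr.
rewrite !gtr0_norm ?mulr_gt0//.
have -> : sin (radius a) * (sin th * sin (radius b) * z) /
    (sin (radius a) * (sin th * sin (radius b) * Num.sqrt (1 + z ^+ 2))) =
    z / Num.sqrt (1 + z ^+ 2).
  by field; rewrite !gt_eqF ?sqrt_1D_gt0.
rewrite -sin_acot -cos_acot cosK// in_itv /=.
by rewrite ltW ?acot_gt0 ?ltW ?acot_lt_pi.
Qed.

(** The slope [acot_slope (x * y)] is decreasing, so it is at least
    [acot_slope y] for [x <= 1], and at most [acot (x * y) <= pi / 2]. *)
Lemma scaled_acot_increment x x' y : 0 <= x -> x <= x' -> x' <= 1 -> 0 <= y ->
  acot_slope y * (x' - x) <= x' * acot (x' * y) - x * acot (x * y)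
    <= 2 * (x' - x).
Proof.
move=> x0 xx' x1 y0.
have d t : x <= t <= x' ->
    is_derive t 1 (fun t => t * acot (t * y)) (acot_slope (t * y)).
  move=> _; have dy : is_derive t 1 (fun t => t * y) y.
    by apply: is_derive_eq; rewrite /GRing.scale /=; ring.
  have d := is_derive_mul (is_derive_id t 1)
    (is_derive1_comp (g := fun t => t * y) (is_derive_acot _) dy).
  apply: is_derive_eq d _; rewrite /acot_slope /=; ring.
apply/andP; split.
  apply: (le_increment_slope xx' d) => t /andP[xt tx].
  by apply: acot_slope_le; rewrite ler_piMl//; lra.
apply: le_trans (ler_norm _) _; apply: (normr_increment_le xx' d) => t /andP[xt tx].
have ty0 : 0 <= t * y by rewrite mulr_ge0//; lra.
rewrite gtr0_norm ?acot_slope_gt0// /acot_slope.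
have : 0 <= t * y / (1 + (t * y) ^+ 2).
  by rewrite divr_ge0// addr_ge0 ?sqr_ge0.
by have := acot_le_pihalf ty0; have := @pihalf_lt2 R; lra.
Qed.

(** Half of the contribution of an edge to the total geodesic curvature of the
    circle at one of its endpoints, as a function of the logarithmic curvature
    [a] of that circle and [b] of the circle at the other endpoint. *)
Definition edge_weight th a b : R :=
  cosr a * acot (cosr a * euclidean_cot th (b - a)).

Lemma edge_weight_gt0 th a b : 0 < edge_weight th a b.
Proof. by rewrite mulr_gt0 ?cosr_gt0 ?acot_gt0. Qed.

Lemma edge_weight_le_cosr th a b : acute th -> edge_weight th a b <= 2 * cosr a.
Proof.
move=> h; rewrite /edge_weight [leLHS]mulrC ler_pM2r ?cosr_gt0//.
apply: le_trans (ltW (@pihalf_lt2 R)); apply: acot_le_pihalf.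
by rewrite mulr_ge0// ltW ?cosr_gt0 ?euclidean_cot_gt0.
Qed.

(** At [cosr a = 1] the weight would be the Euclidean angle. *)
Lemma edge_weight_lt th a b : acute th ->
  edge_weight th a b < acot (euclidean_cot th (b - a)).
Proof.
move=> h; have y0 := euclidean_cot_gt0 (b - a) h.
have /andP[] := scaled_acot_increment (ltW (cosr_gt0 a)) (ltW (cosr_lt1 a))
  (lexx 1) (ltW y0).
rewrite !mul1r -/(edge_weight th a b) => le1 _; rewrite -subr_gt0.
by apply: lt_le_trans le1; rewrite mulr_gt0 ?acot_slope_gt0// subr_gt0 cosr_lt1.
Qed.

(** Together with [edge_weight_lt], this squeezes the weight to the Euclidean
    angle as the radius tends to [0]. *)
Lemma edge_weight_ge th a b : acute th ->
  cosr a * acot (euclidean_cot th (b - a)) <= edge_weight th a b.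
Proof.
move=> h; rewrite ler_pM2l ?cosr_gt0//; apply: acot_le.
by rewrite ler_piMl// ltW ?cosr_lt1 ?euclidean_cot_gt0.
Qed.

Lemma edge_weight_decr th a b b' : acute th -> b <= b' ->
  edge_weight th a b' <= edge_weight th a b.
Proof.
move=> h bb'; rewrite ler_pM2l ?cosr_gt0//; apply: acot_le.
by rewrite ler_pM2l ?cosr_gt0//; apply: euclidean_cot_le => //; rewrite lerD2r.
Qed.

(** Adding the same amount to both logarithmic curvatures keeps [b - a], hence
    the Euclidean angle, so that only [cosr a] moves. This uniform gain along
    the diagonal is the source of the exponential rate. *)
Lemma edge_weight_shift th a b M : acute th ->
  exists2 mu, 0 < mu & forall m m', - M <= m -> m <= m' -> m' <= M ->
    mu * (m' - m) <= edge_weight th (a + m') (b + m') - edge_weight th (a + m) (b + m).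
Proof.
move=> h; have y0 := euclidean_cot_gt0 (b - a) h.
pose nu := cosr (a - M) * (1 - cosr (a + M)).
exists (acot_slope (euclidean_cot th (b - a)) * nu).
  by rewrite !mulr_gt0 ?acot_slope_gt0 ?cosr_gt0 ?subr_gt0 ?cosr_lt1.
move=> m m' Mm mm' m'M.
have dd t : b + t - (a + t) = b - a by ring.
rewrite /edge_weight !dd.
have am : a + m <= a + m' by rewrite lerD2l.
have /andP[h1 _] := scaled_acot_increment (ltW (cosr_gt0 (a + m)))
  (cosr_le am) (ltW (cosr_lt1 _)) (ltW y0).
apply: le_trans h1; rewrite -mulrA ler_pM2l ?acot_slope_gt0//.
have -> : m' - m = (a + m') - (a + m) by ring.
apply: (le_increment_slope am (fun x _ => is_derive_cosr x)) => x /andP[mx xm'].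
have l1 : cosr (a - M) <= cosr x by apply: cosr_le; lra.
have l2 : cosr x <= cosr (a + M) by apply: cosr_le; lra.
have := cosr_gt0 x; have := cosr_lt1 x; have := cosr_gt0 (a - M).
have := cosr_lt1 (a + M); rewrite /nu => *.
apply: ler_pM => //; [exact: ltW|lra|nra].
Qed.

(** Globally Lipschitz: the flow is then governed by a bounded Lipschitz vector
    field on the whole space of logarithmic curvatures. *)
Lemma edge_weight_lipschitz th a b a' b' d : acute th ->
  `|a - a'| <= d -> `|b - b'| <= d ->
  `|edge_weight th a b - edge_weight th a' b'| <= 4 * d.
Proof.
move=> h aa' bb'.
(* First move the factor [cosr], with the Euclidean angle fixed. *)
have step1 : `|edge_weight th a b - cosr a' * acot (cosr a' * euclidean_cot th (b - a))|
    <= 2 * d.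
  have y0 := ltW (euclidean_cot_gt0 (b - a) h).
  have := le_trans (cosr_lipschitz a a') aa'; rewrite /edge_weight.
  have := cosr_gt0 a; have := cosr_gt0 a'.
  have := cosr_lt1 a; have := cosr_lt1 a'.
  move: (cosr a) (cosr a') => x x' x1' x1 x0' x0.
  wlog xx' : x x' x0 x0' x1 x1' / x <= x'.
    move=> w; have [|/ltW] := leP x x'; first exact: w.
    by move=> xx'; rewrite distrC => dd; rewrite distrC; apply: w.
  have /andP[h1 h2] := scaled_acot_increment (ltW x0) xx' (ltW x1') y0.
  rewrite [`|x - x'|]distrC ger0_norm ?subr_ge0// => dd.
  rewrite distrC ger0_norm; first lra.
  apply: le_trans h1; apply: mulr_ge0.
    exact/ltW/acot_slope_gt0.
  by rewrite subr_ge0.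
(* Then move the Euclidean angle, with the factor [cosr] fixed. *)
have step2 d1 d2 :
    `|cosr a' * acot (cosr a' * euclidean_cot th d1) -
      cosr a' * acot (cosr a' * euclidean_cot th d2)| <= `|d1 - d2|.
  wlog dd : d1 d2 / d2 <= d1.
    by move=> w; have [/w//|/ltW/w] := leP d2 d1; rewrite distrC [leRHS]distrC.
  rewrite (ger0_norm (x := d1 - d2)) ?subr_ge0//.
  have x0 := cosr_gt0 a'; have x1 := cosr_lt1 a'.
  move: (cosr a') x0 x1 => x x0 x1.
  pose df t := - (x * (x * (expR t / sin th)) / (1 + (x * euclidean_cot th t) ^+ 2)).
  have D (t : R) : is_derive t 1 (fun t => x * acot (x * euclidean_cot th t)) (df t).
    have := is_derive_scale x (is_derive1_comp
      (g := fun t => x * euclidean_cot th t) (is_derive_acot _)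
      (is_derive_scale x (is_derive_euclidean_cot th t))).
    by move=> h0; apply: is_derive_eq h0 _; rewrite /df; ring.
  rewrite -[leRHS]mul1r; apply: (normr_increment_le dd (fun t _ => D t)) => t _.
  have s0 := acute_sin h; have c0 := acute_cos h; have e0 := expR_gt0 t.
  have y0 := euclidean_cot_gt0 t h.
  have ye : expR t / sin th <= euclidean_cot th t.
    by rewrite ler_pM2r ?invr_gt0// lerDl ltW.
  have q0 : 0 < 1 + (x * euclidean_cot th t) ^+ 2 by rewrite ltr_wpDr ?sqr_ge0.
  have e1 : 0 < expR t / sin th by rewrite divr_gt0.
  rewrite /df normrN ger0_norm; last first.
    by apply: ltW; apply: divr_gt0 => //; do 2! apply: mulr_gt0 => //.
  rewrite ler_pdivrMr// mul1r.
  move: (expR t / sin th) (euclidean_cot th t) ye y0 e1 {q0} => e y ye y0 e1.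
  have : x * (x * e) <= x * y by rewrite ler_pM2l//; nra.
  have := sqr_ge0 (1 - x * y); have := mulr_gt0 x0 y0; nra.
have := step2 (b - a) (b' - a'); rewrite -/(edge_weight th a' b').
have : `|b - a - (b' - a')| <= 2 * d.
  have -> : b - a - (b' - a') = (b - b') - (a - a') by ring.
  by apply: le_trans (ler_normB _ _) _; lra.
move=> h1 h2; rewrite -(subrKA (cosr a' * acot (cosr a' * euclidean_cot th (b - a)))).
by apply: le_trans (ler_normD _ _) _; lra.
Qed.

End Radius.

(** * A first exit principle *)

Section DifferenceQuotient.
Context {R : realType}.

Lemma is_derive_quotient (f : R -> R) (x d : R) :
  is_derive x 1 f d <-> h^-1 * (f (x + h) - f x) @[h --> 0^'] --> d.
Proof.
have E : (fun h : R => h^-1 *: ((f \o shift x) (h *: (1 : R)) - f x)) =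
    (fun h => h^-1 * (f (x + h) - f x)).
  by apply/funext => h /=; rewrite /GRing.scale /= mulr1 [h + x]addrC.
split=> [[df dE]|cf].
  by rewrite -dE /derive E; move: df; rewrite /derivable E.
split; first by rewrite /derivable E; apply/cvg_ex; exists d.
by rewrite /derive E; exact/cvg_lim.
Qed.

End DifferenceQuotient.

Section FirstExit.
Context {R : realType} {I : finType}.

(** At the first time when one of the functions reaches [C], that function would
    have just come from values above [C]. *)
Lemma first_exit (psi dpsi : I -> R -> R) (C : R) :
  (forall i, psi i 0 < C) ->
  (forall i, psi i t @[t --> 0^'+] --> psi i 0) ->
  (forall i (t : R), 0 < t -> is_derive t 1 (psi i) (dpsi i t)) ->
  (forall i t, 0 < t -> (forall j, psi j t <= C) -> psi i t = C ->
    dpsi i t < 0) ->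
  forall i t, 0 <= t -> psi i t < C.
Proof.
move=> psi0 psi_right dpsiE dpsi_lt0 i t.
move=> t_ge0; rewrite ltNge; apply/negP => Ct.
pose B : set R := [set s | 0 <= s /\ exists j, C <= psi j s].
have Bt : B t by split=> //; exists i.
have lB : lbound B 0 by move=> s [].
have hlB : has_lbound B by exists 0.
set t0 := inf B; have t00 : 0 <= t0 by apply: lb_le_inf => //; exists t.
have below s j : 0 <= s -> s < t0 -> psi j s < C.
  move=> s0 st; rewrite ltNge; apply/negP => Cs.
  by have := ge_inf hlB (conj s0 (ex_intro _ j Cs)); rewrite leNgt st.
have {t00} t00 : 0 < t0.
  have : \forall s \near 0^'+, forall j, psi j s < C.
    by apply: filter_forall => j; apply: (cvgr_lt _ (psi_right j)).
  move=> [e /= e0 he]; apply: lt_le_trans e0 _.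
  apply: lb_le_inf; first by exists t.
  move=> s [s0 [j Cj]]; rewrite leNgt; apply/negP => se.
  have [s0'|s_neq0] := eqVneq s 0.
    by move: Cj; rewrite s0' leNgt psi0.
  have s_gt0 : 0 < s by rewrite lt_def s_neq0.
  have := he s; rewrite /ball_ /= sub0r normrN gtr0_norm// => /(_ se s_gt0 j).
  by rewrite ltNge Cj.
have cont j : psi j s @[s --> t0] --> psi j t0.
  by have := is_derive_continuous (dpsiE j _ t00).
have le_at j : psi j t0 <= C.
  rewrite leNgt; apply/negP => Cj.
  have h1 : \forall s \near t0^'-, C < psi j s.
    exact: (cvgr_gt _ (cvg_at_left_filter (cont j)) _ Cj).
  have [s [s1 s2 s3]] : exists s, [/\ C < psi j s, 0 < s & s < t0].
    near (t0^'-) => s; exists s; split; near: s => //.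
      exact: nbhs_left_gt.
    exact: nbhs_left_lt.
  by have := below s j (ltW s2) s3; rewrite ltNge ltW.
have [j ej] : exists j, psi j t0 = C.
  apply: contrapT => nC.
  have lt_at j : psi j t0 < C.
    by rewrite lt_neqAle le_at andbT; apply/eqP => e; apply: nC; exists j.
  have : \forall s \near nbhs t0, forall j, psi j s < C.
    by apply: filter_forall => k; apply: (cvgr_lt _ (cont k)).
  move=> /nbhs_ballP[e /= e0 he].
  have : t0 + e <= t0.
    apply: lb_le_inf; first by exists t.
    move=> s [s0 [j Cj]]; rewrite leNgt; apply/negP => se.
    have [st0|t0s] := ltP s t0; first by have := below s j s0 st0; rewrite ltNge Cj.
    have := he s; rewrite /ball /= distrC ger0_norm ?subr_ge0//.
    by rewrite ltrBlDl => /(_ se j); rewrite ltNge Cj.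
  by rewrite gerDl leNgt e0.
have /is_derive_quotient/cvg_dnbhs_at_left/cvgr_lt := dpsiE j _ t00.
move=> /(_ _ (dpsi_lt0 j _ t00 le_at ej)) q.
have t0N : - t0 < 0 by rewrite oppr_lt0.
have [h [h1 h2 h3]] : exists h,
    [/\ h^-1 * (psi j (t0 + h) - psi j t0) < 0, - t0 < h & h < 0].
  near ((0 : R)^'-) => h; exists h; split; near: h => //.
    exact: nbhs_left_gt.
  exact: nbhs_left_lt.
have : psi j (t0 + h) < C by apply: below; lra.
move: h1; rewrite nmulr_rlt0 ?invr_lt0// subr_gt0 ej => C1 C2.
by have := lt_trans C1 C2; rewrite ltxx.
Unshelve. all: by end_near. Qed.

End FirstExit.

(** * Global solutions of Lipschitz differential equations *)

Section Picard.
Context {R : realType}.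

Lemma lipschitz_continuous (f : R -> R) (M : R) :
  (forall s t, `|f s - f t| <= M * `|s - t|) -> continuous f.
Proof.
move=> fM x; apply/cvgrPdist_lt => e e0; near=> y.
have M0 : 0 < `|M| + 1 by rewrite ltr_wpDl.
have xy : `|x - y| < e / (`|M| + 1).
  by near: y; apply: cvgr_dist_lt; rewrite ?divr_gt0//; exact: cvg_id.
apply: le_lt_trans (fM x y) _.
move: xy; rewrite ltr_pdivlMr// mulrC; apply: le_lt_trans.
by rewrite ler_wpM2r// (le_trans (ler_norm M))// lerDl.
Unshelve. all: by end_near. Qed.

Lemma le_of_eq (x y : R) : x = y -> x <= y.
Proof. by move->. Qed.

(** An antiderivative vanishing at [0]; integrating from [-1] makes [0] an
    interior point, so that the derivative there is two-sided. *)
Definition primitive (f : R -> R) (t : R) : R :=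
  parameterized_integral lebesgue_measure (- 1) t f -
  parameterized_integral lebesgue_measure (- 1) 0 f.

Lemma primitive0 f : primitive f 0 = 0.
Proof. exact: subrr. Qed.

Lemma is_derive_primitive (f : R -> R) (t : R) : continuous f -> 0 <= t ->
  is_derive t 1 (primitive f) (f t).
Proof.
move=> cf t0; rewrite -[f t]subr0.
apply: (is_derive_sub (f := parameterized_integral lebesgue_measure (- 1) ^~ f)
  (g := cst _)).
have t1 : t < t + 1 by rewrite ltrDl.
have i1 : lebesgue_measure.-integrable `[(- 1), t + 1] (EFin \o f).
  apply: continuous_compact_integrable; first exact: segment_compact.
  exact: continuous_subspaceT.
have Nt : - 1 < t by apply: lt_le_trans t0; rewrite oppr_lt0.
have [d dE] := continuous_FTC1_closed t1 i1 Nt (cf t).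
by split; [exact: d|rewrite -derive1E; exact: dE].
Qed.

(** The limit is the supremum of the lower ends of the nested intervals
    [u n - 2 C / 2 ^ n, u n + 2 C / 2 ^ n]. *)
Lemma geometric_limit (u : nat -> R) (C : R) : 0 <= C ->
  (forall n, `|u n.+1 - u n| <= C / 2 ^+ n) ->
  exists l, forall n, `|u n - l| <= 2 * C / 2 ^+ n.
Proof.
move=> C0 hu; pose e n : R := 2 * C / 2 ^+ n.
have eS n : e n = 2 * e n.+1.
  by rewrite /e exprS; field; rewrite expf_neq0.
have e0 n : 0 <= e n by rewrite divr_ge0 ?mulr_ge0 ?exprn_ge0.
have hu' n : `|u n.+1 - u n| <= e n.+1.
  by apply: le_trans (hu n) _; rewrite /e exprS; apply: le_of_eq; field; rewrite expf_neq0.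
have mono n m : u n - e n <= u (n + m)%N - e (n + m)%N /\
    u (n + m)%N + e (n + m)%N <= u n + e n.
  elim: m => [|m [IH1 IH2]]; first by rewrite addn0.
  rewrite addnS; have := hu' (n + m)%N; have := eS (n + m)%N.
  by rewrite ler_norml => ? /andP[? ?]; split; lra.
have cross n m : u n - e n <= u m + e m.
  have [h1 _] := mono n (m - n)%N; have [_ h2] := mono m (n - m)%N.
  rewrite -!maxnE maxnC in h1 h2; have := e0 (maxn m n); lra.
pose S := range (fun n => u n - e n).
have S0 : S !=set0 by exists (u 0 - e 0%N), 0.
have ubS m : ubound S (u m + e m) by move=> _ [n _ <-].
exists (sup S) => n; rewrite -/(e n) ler_distlC; apply/andP; split.
  by apply: ub_le_sup; [exists (u 0%N + e 0%N)|exists n].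
exact: ge_sup.
Qed.

Lemma le_of_geometric (x y M : R) :
  (forall n : nat, x <= y + M / 2 ^+ n) -> x <= y.
Proof.
move=> h; suff c : (fun n => y + M / 2 ^+ n) @ \oo --> y.
  have cy : cvg ((fun n => y + M / 2 ^+ n) @ \oo) by apply/cvg_ex; exists y.
  by rewrite -(cvg_lim _ c)//; apply: limr_ge => //; exact: nearW.
rewrite -[X in _ --> X]addr0; apply: cvgD; first exact: cvg_cst.
have -> : (fun n => M / 2 ^+ n) = geometric M (2^-1).
  by apply/funext => n /=; rewrite exprVn.
by apply: cvg_geometric; rewrite ger0_norm ?invr_ge0// invf_lt1 ?ltr1n.
Qed.

Lemma exponential_bound (f df : R -> R) (A lam : R) : 0 <= A -> f 0 = 0 ->
  (forall t : R, 0 <= t -> is_derive t 1 f (df t)) ->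
  (forall t, 0 <= t -> `|df t| <= A * (lam * expR (lam * t))) ->
  forall t, 0 <= t -> `|f t| <= A * expR (lam * t).
Proof.
move=> A0 f0 hf hdf t t0.
have dE (s : R) : is_derive s 1 (fun s => A * expR (lam * s)) (A * (lam * expR (lam * s))).
  apply: is_derive_scale; rewrite mulrC.
  exact: (is_derive1_comp (g := fun s => lam * s) (is_derive_expR _) (is_derive_linear _ _)).
have hf' x : 0 <= x <= t -> is_derive x 1 f (df x) by move=> /andP[/hf].
have hN x : 0 <= x <= t -> is_derive x 1 (fun s => - f s) (- df x).
  by move=> /hf'; exact: is_derive_opp.
have h1 := le_increment t0 hf' (fun x _ => dE x).
have h2 := le_increment t0 hN (fun x _ => dE x).
rewrite mulr0 expR0 mulr1 f0 subr0 in h1 h2.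
rewrite ler_norml; apply/andP; split.
  have : - f t - - 0 <= A * expR (lam * t) - A.
    by apply: h2 => x /andP[/hdf + _]; rewrite ler_norml => /andP[]; lra.
  lra.
have : f t <= A * expR (lam * t) - A.
  by apply: h1 => x /andP[/hdf + _]; rewrite ler_norml => /andP[]; lra.
lra.
Qed.

Context {I : finType}.
Variables (F : (I -> R) -> I -> R) (B L : R) (k0 : I -> R).

(** The Picard operator; [`|s|] extends the path evenly to negative times, so
    that the integrand is continuous on the whole line. *)
Definition picard (k : R -> I -> R) (t : R) (i : I) : R :=
  k0 i + primitive (fun s => F (k `|s|) i) t.

Definition lipschitz_path (k : R -> I -> R) : Prop :=
  forall i s t, 0 <= s -> 0 <= t -> `|k s i - k t i| <= B * `|s - t|.

Lemma picard0 k i : picard k 0 i = k0 i.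
Proof. by rewrite /picard primitive0 addr0. Qed.

Hypothesis L0 : 0 <= L.
Hypothesis FB : forall k i, `|F k i| <= B.
Hypothesis FL : forall k k' i d, (forall j, `|k j - k' j| <= d) ->
  `|F k i - F k' i| <= L * d.

Lemma is_derive_picard k i (t : R) : lipschitz_path k -> 0 <= t ->
  is_derive t 1 (fun s => picard k s i) (F (k t) i).
Proof.
move=> hk t0; have -> : F (k t) i = 0 + F (k `|t|) i by rewrite add0r ger0_norm.
apply: is_derive_add.
apply: (is_derive_primitive (f := fun s => F (k `|s|) i)) => //.
apply: (@lipschitz_continuous _ (L * B)) => x y; rewrite -mulrA; apply: FL => j.
apply: le_trans (hk _ _ _ _ _) _ => //; rewrite ler_wpM2l ?ler_dist_dist//.
exact: le_trans (normr_ge0 _) (FB k0 i).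
Qed.

Lemma lipschitz_picard k : lipschitz_path k -> lipschitz_path (picard k).
Proof.
move=> hk i s t; wlog ts : s t / t <= s.
  move=> w s0 t0; have [/w|/ltW/w] := leP t s; first exact.
  by rewrite distrC [X in _ * X]distrC; exact.
move=> s0 t0; rewrite [X in _ * X]ger0_norm ?subr_ge0//.
apply: (normr_increment_le (f := picard k ^~ i) (df := fun x => F (k x) i) ts);
  last by move=> x _; exact: FB.
move=> x /andP[tx _]; by apply: is_derive_picard => //; exact: le_trans tx.
Qed.

Let lam := 2 * L + 1.

(** As [2 * L <= lam], the exponential weight makes the operator contract by the
    factor [1 / 2] on the whole half-line. *)
Lemma picard_contraction k k' A : 0 <= A ->
  lipschitz_path k -> lipschitz_path k' ->
  (forall t i, 0 <= t -> `|k t i - k' t i| <= A * expR (lam * t)) ->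
  forall t i, 0 <= t ->
  `|picard k t i - picard k' t i| <= A / 2 * expR (lam * t).
Proof.
move=> A0 hk hk' kk' t i; have A2 : 0 <= A / 2 by rewrite divr_ge0.
apply: (exponential_bound A2 (f := fun t => picard k t i - picard k' t i)
  (df := fun t => F (k t) i - F (k' t) i)) => [|s s0|s s0].
- by rewrite !picard0 subrr.
- by apply: is_derive_sub; exact: is_derive_picard.
apply: le_trans (FL (d := A * expR (lam * s)) _ _) _ => [j|]; first exact: kk'.
have := mulr_ge0 A0 (expR_ge0 (lam * s)); rewrite /lam => *.
have -> : A / 2 * ((2 * L + 1) * expR ((2 * L + 1) * s)) =
  L * (A * expR ((2 * L + 1) * s)) + A * expR ((2 * L + 1) * s) / 2 by field.
lra.
Qed.

(** Picard iteration: the weighted distances of successive iterates decrease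
    geometrically, and the pointwise limit inherits the Lipschitz bound [B] of
    the iterates, which makes it a continuous fixed point. *)
Theorem global_solution : exists k : R -> I -> R, k 0 = k0 /\
  forall i (t : R), 0 <= t -> is_derive t 1 (fun s => k s i) (F (k t) i).
Proof.
pose it n := iter n picard (fun=> k0).
have [[i0 _]|noI] := pselect (exists i : I, True); last first.
  by exists (fun=> k0); split => // i; case: noI; exists i.
have B0 : 0 <= B := le_trans (normr_ge0 _) (FB k0 i0).
have lipit n : lipschitz_path (it n).
  elim: n => [|n IH]; last exact: lipschitz_picard.
  by move=> i s t _ _; rewrite subrr normr0 mulr_ge0.
have step n t i : 0 <= t ->
    `|it n.+1 t i - it n t i| <= B / 2 ^+ n * expR (lam * t).
  elim: n t i => [|n IH] t i t0.
    rewrite expr0 divr1; apply: (exponential_bound B0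
      (f := fun t => it 1%N t i - it 0%N t i) (df := fun t => F k0 i - 0)) => //.
    - by rewrite /= picard0 subrr.
    - move=> s s0; apply: is_derive_sub; last exact: is_derive_cst.
      exact: (is_derive_picard i (lipit 0%N)).
    - move=> s s0; rewrite subr0 (le_trans (FB _ _))// ler_peMr//.
      have l1 : 1 <= lam by rewrite lerDr mulr_ge0.
      apply: mulr_ege1 => //; rewrite -[leLHS]expR0 ler_expR mulr_ge0//.
      exact: le_trans l1.
  have -> : B / 2 ^+ n.+1 = B / 2 ^+ n / 2 :> R.
    by rewrite exprS; field; rewrite expf_neq0.
  apply: (picard_contraction _ (lipit n.+1) (lipit n) IH) => //.
  by rewrite divr_ge0 ?exprn_ge0.
have /choice[K hK] : forall p : R * I, exists l, 0 <= p.1 ->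
    forall n, `|it n p.1 p.2 - l| <= 2 * (B * expR (lam * p.1)) / 2 ^+ n.
  move=> [t i] /=; have [t0|tn] := boolP (0 <= t); last by exists 0.
  have [|n|l hl] := @geometric_limit (fun n => it n t i) (B * expR (lam * t)).
  - by rewrite mulr_ge0 ?expR_ge0.
  - by rewrite mulrAC; exact: step.
  by exists l.
pose k t i := K (t, i).
have kit n t i : 0 <= t -> `|k t i - it n t i| <= 2 * B / 2 ^+ n * expR (lam * t).
  move=> t0; rewrite distrC; apply: le_trans (hK (t, i) t0 n) _.
  by apply: le_of_eq; field; rewrite expf_neq0.
have lipk : lipschitz_path k.
  move=> i s t s0 t0.
  apply: (@le_of_geometric _ _ (2 * B * (expR (lam * s) + expR (lam * t)))) => n.
  have := kit n s i s0; have := kit n t i t0; have := lipit n i s t s0 t0.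
  rewrite !ler_distl => /andP[? ?] /andP[? ?] /andP[? ?].
  have e : 2 * B * (expR (lam * s) + expR (lam * t)) / 2 ^+ n =
    2 * B / 2 ^+ n * expR (lam * s) + 2 * B / 2 ^+ n * expR (lam * t).
    by field; rewrite expf_neq0.
  by rewrite e; apply/andP; split; lra.
have fixk t : 0 <= t -> picard k t = k t.
  move=> t0; apply/funext => i; apply/eqP; rewrite -subr_eq0 -normr_le0.
  apply: (@le_of_geometric _ _ (2 * B * expR (lam * t))) => n; rewrite add0r.
  have h1 := kit n.+1 t i t0.
  have h2 : `|picard k t i - it n.+1 t i| <= 2 * B / 2 ^+ n / 2 * expR (lam * t).
    apply: picard_contraction => // [|s j s0]; last exact: kit.
    by rewrite !(divr_ge0, mulr_ge0, exprn_ge0).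
  have -> : picard k t i - k t i = (picard k t i - it n.+1 t i) - (k t i - it n.+1 t i).
    by ring.
  apply: le_trans (ler_normB _ _) _; apply: le_trans (lerD h2 h1) _.
  by rewrite exprS; apply: le_of_eq; field; rewrite expf_neq0.
exists (picard k); split; first by apply/funext => i; rewrite picard0.
by move=> i t t0; rewrite fixk//; exact: is_derive_picard.
Qed.

End Picard.

(** * Total geodesic curvatures of a circle pattern *)

Section Graph.
Context {R : realType} {V E : finType}.
Variables (ends : E -> {set V}) (Theta : E -> R).
Hypothesis acuteTheta : forall e, acute (Theta e).
Implicit Types (k : V -> R) (v : V) (e : E) (X : {set V}).

Definition endpoint_weight k e v : R :=
  edge_weight (Theta e) (k v) (k (other_end ends v e)).

(** The total geodesic curvature as a function of the logarithmic curvatures. *)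
Definition curv k v : R := \sum_(e | v \in ends e) 2 * endpoint_weight k e v.

Definition radii_of k : {ffun V -> R} := [ffun v => radius (k v)].

Lemma radii_of_admissible k : admissible_radii (radii_of k).
Proof. by move=> v; rewrite ffunE radius_gt0 radius_lt. Qed.

Lemma total_geodesic_curvatureE k v :
  total_geodesic_curvature ends Theta (radii_of k) v = curv k v.
Proof.
rewrite /total_geodesic_curvature /circle_length /geodesic_curvature.
have s0 : sin (radii_of k v) != 0 by rewrite ffunE gt_eqF ?sin_radius_gt0.
rewrite -mulrA [sin _ * _]mulrC divfK// /cone_angle mulr_suml.
apply: eq_bigr => e _; rewrite -mulrA; congr (_ * _).
by rewrite /beta !ffunE triangle_angleE// mulrC.
Qed.

(** Monotonicity off the diagonal: enlarging the curvature of the other circles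
    lowers the total curvature at [v]. This makes a maximum principle work. *)
Lemma curv_decr k k' v : k v = k' v -> (forall w, k w <= k' w) ->
  curv k' v <= curv k v.
Proof.
move=> kv kk'; apply: ler_sum => e _; rewrite ler_pM2l//.
by rewrite /endpoint_weight kv; exact: edge_weight_decr.
Qed.

Lemma curv_ge0 k v : 0 <= curv k v.
Proof. by apply: sumr_ge0 => e _; rewrite mulr_ge0// ltW ?edge_weight_gt0. Qed.

Lemma curv_le_cosr k v : curv k v <= 4 * #|E|%:R * cosr (k v).
Proof.
rewrite [4 * _]mulrC -mulrA; apply: ler_sum_card => [|e _].
  by rewrite mulr_ge0// ltW ?cosr_gt0.
have := edge_weight_le_cosr (k v) (k (other_end ends v e)) (acuteTheta e).
rewrite /endpoint_weight; lra.
Qed.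

Lemma curv_lipschitz k k' v d : (forall w, `|k w - k' w| <= d) ->
  `|curv k v - curv k' v| <= 8 * #|E|%:R * d.
Proof.
move=> kk'; have d0 : 0 <= d := le_trans (normr_ge0 _) (kk' v).
rewrite -sumrB; apply: le_trans (ler_norm_sum _ _ _) _.
rewrite [8 * _]mulrC -mulrA; apply: ler_sum_card => [|e _].
  by rewrite mulr_ge0.
rewrite -mulrBr normrM ger0_norm//.
have := edge_weight_lipschitz (acuteTheta e) (kk' v) (kk' (other_end ends v e)).
rewrite /endpoint_weight; lra.
Qed.

Lemma curv_shift k v M : 0 < curv k v ->
  exists2 mu, 0 < mu & forall m m', - M <= m -> m <= m' -> m' <= M ->
    mu * (m' - m) <=
    curv (fun w => k w + m') v - curv (fun w => k w + m) v.
Proof.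
move=> k0; have [e0 ve0] : exists e, v \in ends e.
  apply/existsP; apply: contraTT k0 => /existsPn noe.
  by rewrite /curv big_pred0 ?ltxx// => e; exact/negbTE/noe.
have shift e := edge_weight_shift (k v) (k (other_end ends v e)) M (acuteTheta e).
have [mu mu0 hmu] := shift e0; exists (2 * mu); first by rewrite mulr_gt0.
move=> m m' Mm mm' m'M.
rewrite -sumrB (bigD1 e0)//= -mulrBr -mulrA -[leLHS]addr0; apply: lerD.
  by rewrite ler_pM2l//; exact: hmu.
apply: sumr_ge0 => e _; rewrite -mulrBr mulr_ge0//.
have [nu nu0 hnu] := shift e.
by apply: le_trans (hnu m m' Mm mm' m'M); rewrite mulr_ge0 ?subr_ge0// ltW.
Qed.

Lemma sum_curv k X : \sum_(v in X) curv k v =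
  2 * \sum_(e in incident_edges ends X)
        \sum_(v in X | v \in ends e) endpoint_weight k e v.
Proof.
rewrite (exchange_big_dep (mem (incident_edges ends X))) /=; last first.
  by move=> v e vX ve; rewrite inE; apply/existsP; exists v; rewrite vX.
by rewrite mulr_sumr; apply: eq_bigr => e _; rewrite mulr_sumr.
Qed.

Hypothesis ends2 : two_ended ends.

Lemma other_endE (u w : V) e : u != w -> ends e = [set u; w]%SET -> other_end ends u e = w.
Proof.
move=> uw ee; rewrite /other_end ee setU1K ?inE//.
by case: pickP => [x|/(_ w)]; rewrite inE ?eqxx// => /eqP.
Qed.

Lemma incident_sum k X e : e \in incident_edges ends X -> exists u w,
  u \in X /\
  \sum_(v in X | v \in ends e) endpoint_weight k e v =
    edge_weight (Theta e) (k u) (k w) +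
    (if w \in X then edge_weight (Theta e) (k w) (k u) else 0).
Proof.
rewrite inE => /existsP[u /andP[uX ue]].
have [w uw ee] : exists2 w, u != w & ends e = [set u; w]%SET.
  have /cards2P [x [y [xy exy]]] : #|ends e| == 2%N by rewrite ends2.
  have : u \in [set x; y]%SET by rewrite -exy.
  rewrite !inE => /orP[]/eqP ->; first by exists y.
  by exists x; [rewrite eq_sym|rewrite exy finset.setUC].
exists u, w; split => //.
rewrite (bigD1 u) ?uX//= /endpoint_weight (other_endE uw ee); congr (_ + _).
have wu : w != u by rewrite eq_sym.
have ee' : ends e = [set w; u]%SET by rewrite ee finset.setUC.
case: ifPn => wX.
  rewrite (big_pred1 w) ?(other_endE wu ee')// => v; rewrite ee !inE.
  have [->|vu] := eqVneq v u; rewrite ?(negbTE uw) ?andbF//= andbT.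
  by have [->|] := eqVneq v w; rewrite ?wX ?andbF.
rewrite big_pred0// => v; rewrite ee !inE.
have [->|vu] := eqVneq v u; rewrite ?andbF//= andbT.
by have [->|] := eqVneq v w; rewrite ?(negbTE wX) ?andbF.
Qed.

Lemma incident_sum_lt k X e : e \in incident_edges ends X ->
  \sum_(v in X | v \in ends e) endpoint_weight k e v < Theta e.
Proof.
move=> /(incident_sum k)[u [w [_ ->]]]; have h := acuteTheta e.
have := edge_weight_lt (k u) (k w) h; have := edge_weight_lt (k w) (k u) h.
have := euclidean_angle_sum (k w - k u) h; rewrite opprB.
have := euclidean_angle_lt (k w - k u) h.
case: ifP => _; lra.
Qed.

(** The matching lower bound, sharp when [a] tends to infinity with [b] fixed:
    then [b - a] tends to [- oo] and the Euclidean angle to [Theta e]. *)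
Lemma incident_sum_ge k X e a b : e \in incident_edges ends X ->
  (forall v, v \in X -> a <= k v) -> (forall v, v \notin X -> k v <= b) ->
  cosr a * acot (euclidean_cot (Theta e) (b - a)) <=
  \sum_(v in X | v \in ends e) endpoint_weight k e v.
Proof.
move=> /(incident_sum k)[u [w [uX ->]]] ha hb; have h := acuteTheta e.
have lo u' w' : u' \in X -> cosr a * acot (euclidean_cot (Theta e) (k w' - k u')) <=
    edge_weight (Theta e) (k u') (k w').
  move=> u'X; apply: le_trans (edge_weight_ge _ _ h).
  by rewrite ler_pM2r ?acot_gt0// cosr_le// ha.
case: ifPn => wX; last first.
  rewrite addr0; apply: le_trans (lo u w uX).
  rewrite ler_pM2l ?cosr_gt0//; apply: acot_le; apply: euclidean_cot_le => //.
  by rewrite lerB ?ha ?hb.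
apply: le_trans (lerD (lo u w uX) (lo w u wX)).
rewrite -mulrDr -(opprB (k w)) euclidean_angle_sum// ler_pM2l ?cosr_gt0//.
exact/ltW/euclidean_angle_lt.
Qed.

(** Each weight is less than its Euclidean angle, and the two Euclidean angles
    of an edge [e] are less than [Theta e], and add up to it. *)
Lemma sum_curv_lt k X : (forall v, 0 < curv k v) -> X != finset.set0 ->
  \sum_(v in X) curv k v < 2 * \sum_(e in incident_edges ends X) Theta e.
Proof.
move=> k0 /set0Pn[v vX]; rewrite sum_curv ltr_pM2l//.
have [e ve] : exists e, v \in ends e.
  apply/existsP; apply: contraTT (k0 v) => /existsPn noe.
  by rewrite /curv big_pred0 ?ltxx// => e; exact/negbTE/noe.
apply: ltr_sum => [|e' eX]; last exact: incident_sum_lt.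
apply/hasP; exists e; first by rewrite mem_index_enum.
by rewrite inE; apply/existsP; exists v; rewrite vX.
Qed.

End Graph.

(** * Existence of the prescribed pattern *)

Section Perron.
Context {R : realType} {V E : finType}.
Variables (ends : E -> {set V}) (Theta : E -> R) (Lhat : V -> R).
Hypothesis acuteTheta : forall e, acute (Theta e).
Hypothesis ends2 : two_ended ends.
Implicit Types (k : V -> R) (v : V).

Definition critical k : Prop := forall v, curv ends Theta k v = Lhat v.

Definition subsolution k : Prop := forall v, curv ends Theta k v <= Lhat v.

(** At [v], the maximum agrees with one of the two functions and is at least as
    large elsewhere, so [curv_decr] applies. *)
Lemma subsolution_max k k' : subsolution k -> subsolution k' ->
  subsolution (fun v => Num.max (k v) (k' v)).
Proof.
move=> hk hk' v; case: (leP (k v) (k' v)) => kk'.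
  apply: le_trans (hk' v); apply: curv_decr => // [|w].
    exact/esym/max_idPr.
  by rewrite le_max lexx orbT.
apply: le_trans (hk v); apply: curv_decr => // [|w].
  exact/esym/max_idPl/ltW.
by rewrite le_max lexx.
Qed.

(** When all curvatures are small, all circles are almost great circles and the
    total geodesic curvatures are close to [0]. *)
Lemma subsolution_exists : (forall v, 0 < Lhat v) -> exists k, subsolution k.
Proof.
move=> /finite_uniform_gt0[m m0 hm].
have q0 : 0 < 4 * #|E|%:R + 1 :> R by rewrite ltr_wpDl// mulr_ge0.
exists (fun=> ln (m / (4 * #|E|%:R + 1))) => v.
apply: le_trans (hm v); apply: le_trans (curv_le_cosr _ acuteTheta _ _) _.
apply: (@le_trans _ _ ((4 * #|E|%:R + 1) * (m / (4 * #|E|%:R + 1)))); last first.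
  by rewrite mulrC divfK// gt_eqF.
apply: ler_pM; [by rewrite mulr_ge0|exact/ltW/cosr_gt0|by rewrite lerDl|].
by rewrite -[leRHS]lnK ?posrE ?divr_gt0// cosr_le_expR.
Qed.

Lemma subsolution_directed (T : V -> R) (s : seq V) : (exists k, subsolution k) ->
  (forall v, v \in s -> exists2 k, subsolution k & T v <= k v) ->
  exists2 k, subsolution k & forall v, v \in s -> T v <= k v.
Proof.
move=> [k0 hk0]; elim: s => [|v s IH] hs; first by exists k0.
have [|k hk kT] := IH; first by move=> w ws; apply: hs; rewrite inE ws orbT.
have [k' hk' k'T] := hs v (mem_head v s).
exists (fun w => Num.max (k w) (k' w)); first exact: subsolution_max.
move=> w; rewrite inE le_max => /predU1P[->|/kT ->//].
by rewrite k'T orbT.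
Qed.

Hypothesis Lhat_gt0 : forall v, 0 < Lhat v.
Hypothesis Lhat_lt : forall X : {set V}, X != finset.set0 ->
  \sum_(v in X) Lhat v < 2 * \sum_(e in incident_edges ends X) Theta e.

Lemma weight_cvg (th b : R) : acute th ->
  cosr a * acot (euclidean_cot th (b - a)) @[a --> +oo] --> th.
Proof.
move=> h; rewrite -[X in _ --> X]mul1r; apply: cvgM; first exact: cosr_cvg1.
rewrite -[X in _ --> X](acot_cot h).
apply: (@cvg_comp _ _ _ (fun a => euclidean_cot th (b - a)) (@acot R)); last first.
  exact: continuous_acot.
apply: cvgMl; rewrite -[X in _ --> X]add0r; apply: cvgD; last exact: cvg_cst.
rewrite -[X in _ --> X](mulr0 (expR b)).
under eq_fun do rewrite expRD.
by apply: cvgM; [exact: cvg_cst|exact: cvgr_expR].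
Qed.

(** If the subsolutions were unbounded exactly at the vertices of [X], some of
    them would exceed any [N] on [X] while staying bounded off [X]. As [N] grows,
    the lower bound on the total curvature of [X] tends to the excluded value. *)
Lemma subsolution_bounded : exists b, forall k, subsolution k -> forall v, k v <= b v.
Proof.
pose bounded v := exists b, forall k, subsolution k -> k v <= b.
pose X : {set V} := [set v | ~~ `[< bounded v >]]%SET.
have notX v : v \notin X -> bounded v by rewrite inE negbK => /asboolP.
have [X0|X0] := eqVneq X finset.set0.
  have /choice[b hb] : forall v, bounded v by move=> v; apply: notX; rewrite X0 inE.
  by exists b => k hk v; exact: hb.
have [b hb] : exists b, forall k, subsolution k -> forall v, v \notin X -> k v <= b.
  have /choice[b hb] : forall v, exists b, 0 <= b /\
      (v \notin X -> forall k, subsolution k -> k v <= b).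
    move=> v; have [/notX[b hb]|vX] := boolP (v \notin X); last by exists 0.
    exists `|b|; split=> // _ k /hb /le_trans; apply; exact: ler_norm.
  exists (\sum_v b v) => k hk v vX; apply: le_trans ((hb v).2 vX k hk) _.
  by rewrite (bigD1 v)//= lerDl sumr_ge0// => w _; exact: (hb w).1.
have large N : 2 * \sum_(e in incident_edges ends X)
    cosr N * acot (euclidean_cot (Theta e) (b - N)) <= \sum_(v in X) Lhat v.
  have [|v|k hk kN] := @subsolution_directed (fun=> N) (enum X).
  - exact: subsolution_exists.
  - rewrite mem_enum inE => /asboolPn nb; apply: contrapT => nk; apply: nb.
    exists N => k hk; rewrite leNgt; apply/negP => /ltW Nk.
    by apply: nk; exists k.
  apply: (@le_trans _ _ (\sum_(v in X) curv ends Theta k v)); last exact: ler_sum.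
  rewrite sum_curv ler_pM2l//; apply: ler_sum => e eX.
  apply: incident_sum_ge => // v vX; first by apply: kN; rewrite mem_enum.
  exact: hb.
have c : 2 * \sum_(e in incident_edges ends X)
    cosr N * acot (euclidean_cot (Theta e) (b - N)) @[N --> +oo] -->
    2 * \sum_(e in incident_edges ends X) Theta e.
  apply: cvgMr; apply: cvg_big => [|e _]; last exact: weight_cvg.
  exact: add_continuous.
have := Lhat_lt X0; rewrite ltNge -(cvg_lim _ c)// => /negP; case.
apply: limr_le; first by apply/cvg_ex; eexists; exact: c.
exact: nearW.
Qed.

(** The supremum of the subsolutions: being a subsolution is a closed condition,
    and where the inequality is strict there is room to raise the value. *)
Lemma critical_exists : exists k, critical k.
Proof.
have [b hb] := subsolution_bounded; have [k0 hk0] := subsolution_exists Lhat_gt0.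
pose S v : set R := [set k v | k in subsolution].
have hS v : has_sup (S v).
  split; first by exists (k0 v), k0.
  by exists (b v) => _ [k hk <-]; exact: hb.
pose k v := sup (S v).
have le_k k' : subsolution k' -> forall v, k' v <= k v.
  by move=> hk' v; apply: ub_le_sup; [exact: (hS v).2|exists k'].
have approx d v : 0 < d ->
    curv ends Theta k v <= Lhat v + 8 * #|E|%:R * d.
  move=> d0.
  have [|w _|k' hk' k'd] := @subsolution_directed (fun w => k w - d) (enum V).
  - by exists k0.
  - have [_ [k' hk' <-] lt_k'] := sup_adherent d0 (hS w).
    by exists k' => //; exact: ltW.
  have near_k w : `|k w - k' w| <= d.
    have := le_k _ hk' w; have := k'd w; rewrite mem_enum => /(_ isT).
    by rewrite ler_norml => *; apply/andP; split; lra.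
  have := curv_lipschitz ends acuteTheta v near_k.
  rewrite ler_norml => /andP[_]; have := hk' v; lra.
have room d v : 0 < d -> exists2 d', 0 < d' & 8 * #|E|%:R * d' <= d :> R.
  move=> d0; have q0 : 0 < 8 * #|E|%:R + 1 :> R by rewrite ltr_wpDl// mulr_ge0.
  exists (d / (8 * #|E|%:R + 1)); first by rewrite divr_gt0.
  by rewrite mulrA ler_pdivrMr// mulrC ler_pM2l// lerDl.
have sub_k : subsolution k.
  move=> v; rewrite leNgt; apply/negP => gt.
  have [|d d0 hd] := room ((curv ends Theta k v - Lhat v) / 2) v.
    by rewrite divr_gt0// subr_gt0.
  have := approx d v d0; lra.
exists k => v; apply/eqP; rewrite eq_le sub_k leNgt; apply/negP => lt.
have [|d d0 hd] := room (Lhat v - curv ends Theta k v) v; first by rewrite subr_gt0.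
pose k' w := if w == v then k w + d else k w.
have kk' w : k w <= k' w by rewrite /k'; case: ifP => // _; rewrite lerDl ltW.
have near_k w : `|k' w - k w| <= d.
  rewrite /k'; case: ifP => _; last by rewrite subrr normr0 ltW.
  by rewrite addrAC subrr add0r ger0_norm// ltW.
have sub_k' : subsolution k'.
  move=> w; have [->|wv] := eqVneq w v.
    have := curv_lipschitz ends acuteTheta v near_k.
    rewrite ler_norml => /andP[_]; lra.
  apply: le_trans (sub_k w); apply: curv_decr => //.
  by rewrite /k' (negbTE wv).
have := le_k _ sub_k' v; rewrite /k' eqxx; lra.
Qed.

End Perron.

(** * The flow *)

Section Flow.
Context {R : realType} {V E : finType}.
Variables (ends : E -> {set V}) (Theta : E -> R) (Lhat : V -> R).
Hypothesis acuteTheta : forall e, acute (Theta e).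
Hypothesis Lhat_gt0 : forall v, 0 < Lhat v.
Implicit Types (k : R -> V -> R) (ks : V -> R) (v : V).

Local Notation curv := (curv ends Theta).
Local Notation critical := (critical ends Theta Lhat).

(** In logarithmic curvatures the flow is [dk_v/dt = Lhat_v - L_v]. *)
Definition log_flow k : Prop :=
  (forall v, k t v @[t --> 0^'+] --> k 0 v) /\
  (forall v (t : R), 0 < t -> is_derive t 1 (k ^~ v) (Lhat v - curv (k t) v)).

Lemma curv_shift_uniform ks M : critical ks ->
  exists2 mu, 0 < mu & forall v m, 0 <= m -> m <= M ->
    mu * m <= curv (fun w => ks w + m) v - Lhat v /\
    mu * m <= Lhat v - curv (fun w => ks w - m) v.
Proof.
move=> crit; have [|mu hmu] := @choice _ _ (fun v mu => 0 < mu /\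
    forall m, 0 <= m -> m <= M ->
    mu * m <= curv (fun w => ks w + m) v - Lhat v /\
    mu * m <= Lhat v - curv (fun w => ks w - m) v).
  move=> v; have pos : 0 < curv ks v by rewrite crit.
  have [mu mu0 hmu] := curv_shift acuteTheta M pos.
  have e0 : curv (fun w => ks w + 0) v = Lhat v.
    by rewrite -crit; congr curv; apply/funext => w; rewrite addr0.
  exists mu; split=> // m m0 mM; split.
    by have := hmu 0 m; rewrite subr0 e0; apply; lra.
  by have := hmu (- m) 0; rewrite sub0r opprK e0; apply; lra.
have [nu nu0 hnu] := finite_uniform_gt0 (fun v => (hmu v).1).
exists nu => // v m m0 mM; have [h1 h2] := (hmu v).2 m m0 mM.
by split; apply: le_trans; [|exact: h1| |exact: h2]; rewrite ler_wpM2r.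
Qed.

(** A maximum principle: where the distance [m] to the critical point [ks] is
    largest, [curv_decr] compares [k] with [ks] shifted by [m], so this distance
    decreases at a rate at least [mu * m]. *)
Lemma exponential_convergence k ks : critical ks -> log_flow k ->
  exists C c, [/\ 0 < C, 0 < c & forall t v, 0 <= t ->
    `|k t v - ks v| <= C * expR (- (c * t))].
Proof.
move=> crit [k0 kd]; pose C := 1 + \sum_v `|k 0 v - ks v|.
have Cv v : `|k 0 v - ks v| < C.
  by rewrite /C (bigD1 v)//= addrCA ltrDl ltr_wpDr// sumr_ge0.
have C0 : 0 < C by rewrite ltr_wpDr// sumr_ge0.
have [mu mu0 hmu] := curv_shift_uniform C crit.
(* Any rate below [mu] leaves the strict decrease needed at a first exit. *)
pose c := mu / 2; have c0 : 0 < c by rewrite divr_gt0.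
exists C, c; split=> // t v t0.
(* [sg true] and [sg false] select the two signs of the deviation. *)
pose sg (b : bool) (x : R) := if b then x else - x.
pose psi (i : V * bool) t := expR (c * t) * sg i.2 (k t i.1 - ks i.1).
pose dpsi (i : V * bool) t := expR (c * t) * sg i.2 (Lhat i.1 - curv (k t) i.1) +
  sg i.2 (k t i.1 - ks i.1) * (c * expR (c * t)).
have dE (s : R) : is_derive s 1 (fun s => expR (c * s)) (c * expR (c * s)).
  rewrite mulrC.
  exact: (is_derive1_comp (g := *%R c) (is_derive_expR _) (is_derive_linear _ _)).
suff lt_C i : psi i t < C.
  have := lt_C (v, true); have := lt_C (v, false); rewrite /psi /sg /=.
  rewrite mulrC -ltr_pdivlMr ?expR_gt0// => h1.
  rewrite mulrC -ltr_pdivlMr ?expR_gt0// => h2.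
  by rewrite expRN ler_norml; apply/andP; split; lra.
move: i t t0; apply: (@first_exit _ _ psi dpsi C).
- move=> [w b]; rewrite /psi mulr0 expR0 mul1r /=.
  by have := Cv w; rewrite ltr_norml /sg; case: b => /andP[]; lra.
- move=> [w b]; apply: cvgM.
    by apply: cvg_at_right_filter; exact: is_derive_continuous (dE 0).
  rewrite /sg /=; case: b; last apply: cvgN.
    by apply: cvgB; [exact: k0|exact: cvg_cst].
  by apply: cvgB; [exact: k0|exact: cvg_cst].
- move=> [w b] t t0; apply: (is_derive_mul (f := fun t => expR (c * t))
    (g := fun t => sg b (k t w - ks w)) (dE t)).
  have d : is_derive t 1 (fun t => k t w - ks w) (Lhat w - curv (k t) w).
    rewrite -[X in is_derive _ _ _ X]subr0.
    exact: (is_derive_sub (kd w t t0) (is_derive_cst (ks w) t 1)).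
  by rewrite /sg; case: b => //; exact: is_derive_opp.
move=> [w b] t t0; rewrite /psi /dpsi /=.
have e1 : 1 < expR (c * t) by rewrite expR_gt1 mulr_gt0.
move: (expR (c * t)) e1 => e e1 le_C eC.
have e0 : 0 < e by lra.
have [m mE] : exists m, m = sg b (k t w - ks w) by eexists.
rewrite -mE in eC *; have emC : m * e = C by rewrite mulrC.
have m0 : 0 < m by rewrite -(pmulr_lgt0 _ e0) emC.
have mC : m <= C by rewrite -emC ler_peMr ?ltW.
have le_m u : sg b (k t u - ks u) <= m.
  by rewrite -(ler_pM2l e0) eC; have := le_C (u, b).
have [h1 h2] := hmu w m (ltW m0) mC.
suff : sg b (Lhat w - curv (k t) w) <= - (mu * m).
  move: emC; rewrite /c => emC h; nra.
move: le_m mE; rewrite /sg; case: b => le_m mE.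
  suff : curv (fun u => ks u + m) w <= curv (k t) w by lra.
  by apply: curv_decr => // [|u]; [rewrite mE; ring|have := le_m u; lra].
suff : curv (k t) w <= curv (fun u => ks u - m) w by lra.
by apply: curv_decr => // [|u]; [rewrite mE; ring|have := le_m u; lra].
Qed.

(** A second critical point is a stationary solution, attracted by the first. *)
Lemma critical_unique ks ks' : critical ks -> critical ks' -> ks = ks'.
Proof.
move=> crit crit'; have [|C [c [C0 c0 h]]] := @exponential_convergence (fun=> ks) ks' crit'.
  split=> [v|v t _]; first exact: cvg_cst.
  by rewrite crit subrr; exact: is_derive_cst.
apply/funext => v; apply/eqP; rewrite -subr_eq0 -normr_le0 leNgt.
apply/negP => /(expR_small C0 c0)[T T0 /(_ T (lexx T))].
by rewrite ltNge h.
Qed.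

(** Otherwise the velocity at some vertex stays away from [0] near the limit,
    and the solution moves by a definite amount in each unit of time. *)
Lemma limit_critical k ks : log_flow k ->
  (forall v, k t v @[t --> +oo] --> ks v) -> critical ks.
Proof.
move=> [_ kd] kks v; apply/eqP; rewrite eq_sym -subr_eq0; apply/eqP.
set l := _ - _; apply/eqP; apply: contrapT => /negP l0.
have {}l0 : 0 < `|l| by rewrite normr_gt0.
(* Once [k] stays within [d] of [ks], the velocity at [v] varies by at most
   [8 * #|E| * d] and the position by at most [2 * d]. *)
have q0 : 0 < 8 * #|E|%:R + 2 :> R by rewrite ltr_wpDl// mulr_ge0.
pose d := `|l| / (4 * (8 * #|E|%:R + 2)).
have d0 : 0 < d by rewrite divr_gt0// mulr_gt0.
have dl : 8 * #|E|%:R * d + 2 * d = `|l| / 4 by rewrite /d; field; rewrite gt_eqF.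
have n0 : 0 <= 8 * #|E|%:R * d by rewrite !mulr_ge0// ltW.
have : \forall t \near +oo, forall w, `|k t w - ks w| <= d.
  apply: filter_forall => w; have /cvgrPdist_le/(_ d d0) := kks w.
  by apply: filterS => t; rewrite distrC.
move=> [T0 [_ near_d]]; pose T := Num.max 1 (T0 + 1).
have T1 : 1 <= T by rewrite le_max lexx.
have TT0 : T0 + 1 <= T by rewrite le_max lexx orbT.
have TS : T <= T + 1 by rewrite lerDl.
have [x|x xT] := mean_value TS (f := k ^~ v) (df := fun t => Lhat v - curv (k t) v).
  by move=> /andP[Tx _]; apply: kd; lra.
rewrite addrAC subrr add0r mulr1 => inc.
have a1 : `|k T v - ks v| <= d by apply: near_d; lra.
have a2 : `|k (T + 1) v - ks v| <= d by apply: near_d; lra.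
have a3 w : `|k x w - ks w| <= d by apply: near_d; move/andP: xT; lra.
have := curv_lipschitz ends acuteTheta v a3; move: a1 a2.
rewrite !ler_norml => /andP[? ?] /andP[? ?] /andP[].
move=> ? ?; have : `|l| <= `|l| / 2.
  by rewrite {1}/l ler_norml; apply/andP; split; lra.
lra.
Qed.

Lemma log_flow_exists ks0 : exists k, k 0 = ks0 /\
  forall v (t : R), 0 <= t -> is_derive t 1 (k ^~ v) (Lhat v - curv (k t) v).
Proof.
apply: (@global_solution R V (fun ks v => Lhat v - curv ks v)
  (\sum_v Lhat v + 4 * #|E|%:R) (8 * #|E|%:R) ks0) => [|k v|k k' v d kk'].
- by rewrite mulr_ge0.
- have h1 := curv_ge0 ends Theta k v; have h2 := curv_le_cosr ends acuteTheta k v.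
  have h3 : 4 * #|E|%:R * cosr (k v) <= 4 * #|E|%:R.
    by rewrite ler_piMr ?mulr_ge0// ltW ?cosr_lt1.
  have h4 : Lhat v <= \sum_w Lhat w.
    by rewrite (bigD1 v)//= lerDl sumr_ge0// => w _; exact: ltW.
  have := Lhat_gt0 v; rewrite ler_norml => ?; apply/andP; split; lra.
- have := curv_lipschitz ends acuteTheta v kk'.
  by rewrite distrC; congr (`|_| <= _); ring.
Qed.

Lemma flow_solution_of_log k :
  (forall v (t : R), 0 <= t -> is_derive t 1 (k ^~ v) (Lhat v - curv (k t) v)) ->
  flow_solution ends Theta Lhat (fun t => radii_of (k t)).
Proof.
move=> kd t t0; split=> [|v]; first exact: radii_of_admissible.
have := is_derive1_comp (is_derive_radius (k t v)) (kd v t t0).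
move=> /is_derive_quotient q; rewrite total_geodesic_curvatureE// ffunE.
have -> : (curv (k t) v - Lhat v) / 2 * sin (2 * radius (k t v)) =
    - (sin (radius (k t v)) * cosr (k t v)) * (Lhat v - curv (k t) v).
  by rewrite mulr_natl sin_mulr2n /cosr; field.
under eq_fun do rewrite !ffunE.
by apply: cvg_trans q; apply: cvg_app; exact: cvg_within.
Qed.

Lemma is_derive_log_curvature (r : R) : 0 < r < pi / 2 ->
  is_derive r 1 log_curvature (- (sin r * cos r)^-1).
Proof.
move=> hr; have s0 := sin_gt0_pihalf hr.
have c0 : 0 < cos r.
  by apply: cos_gt0_pihalf; move: hr; have := pi_gt0 R; lra.
apply: is_derive_opp.
have d := is_derive1_comp (g := tan) (is_derive1_ln (divr_gt0 s0 c0))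
  (is_derive_tan (lt0r_neq0 c0)).
by apply: is_derive_eq d _; rewrite /tan; field; rewrite !gt_eqF.
Qed.

Lemma radii_of_log (r : {ffun V -> R}) : admissible_radii r ->
  radii_of (fun v => log_curvature (r v)) = r.
Proof. by move=> hr; apply/ffunP => v; rewrite ffunE log_curvatureK. Qed.

(** At [t = 0] only right continuity survives, since the derivative is
    one-sided there. *)
Lemma log_flow_of_solution rt : flow_solution ends Theta Lhat rt ->
  log_flow (fun t v => log_curvature (rt t v)).
Proof.
move=> sol; split=> v; last first.
  move=> t t0; have [adm /(_ v) q] := sol t (ltW t0).
  have := adm v => hr; have s0 := sin_gt0_pihalf hr.
  have c0 : 0 < cos (rt t v).
    by apply: cos_gt0_pihalf; move: hr; have := pi_gt0 R; lra.
  have d : is_derive t 1 (fun s => rt s v)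
      ((total_geodesic_curvature ends Theta (rt t) v - Lhat v) / 2 * sin (2 * rt t v)).
    apply/is_derive_quotient; apply: cvg_trans q; apply: cvg_app => A hA.
    have tN : - t < 0 by rewrite oppr_lt0.
    have : \forall h \near (0 : R)^', 0 <= t + h.
      near=> h; rewrite -lerBlDl sub0r ltW//; near: h; apply: cvg_within.
      exact: (cvgr_gt _ (@cvg_id _ (nbhs (0 : R)))).
    have hA' : \forall h \near (0 : R)^', 0 <= t + h -> A h := hA.
    by apply: filterS2 hA' => h; apply.
  have := is_derive1_comp (g := fun s => rt s v) (is_derive_log_curvature hr) d.
  move=> d'; apply: is_derive_eq d' _.
  rewrite -(total_geodesic_curvatureE ends acuteTheta) radii_of_log//.
  rewrite mulr_natl sin_mulr2n.
  by field; rewrite !gt_eqF.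
have [adm /(_ v) q] := sol 0 (lexx 0).
have cl := is_derive_continuous (is_derive_log_curvature (adm v)).
suff rt0 : rt t v @[t --> 0^'+] --> rt 0 v by exact: cvg_comp rt0 cl.
have q' : h^-1 * (rt (0 + h) v - rt 0 v) @[h --> 0^'+] -->
    (total_geodesic_curvature ends Theta (rt 0) v - Lhat v) / 2 * sin (2 * rt 0 v).
  apply: cvg_trans q; apply: cvg_app => A hA.
  have hA' : \forall h \near (0 : R), h != 0 -> 0 <= 0 + h -> A h := hA.
  have : \forall h \near (0 : R), 0 < h -> A h; last by [].
  by apply: filterS hA' => h Ah h0; apply: Ah; rewrite ?add0r ?ltW ?gt_eqF.
have z : (h : R) @[h --> 0^'+] --> (0 : R) by apply: cvg_at_right_filter; exact: cvg_id.
have lim : rt 0 v + h * (h^-1 * (rt (0 + h) v - rt 0 v)) @[h --> 0^'+] --> rt 0 v.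
  rewrite [X in _ --> X](_ : _ = rt 0 v + 0 * ((total_geodesic_curvature ends Theta (rt 0) v -
      Lhat v) / 2 * sin (2 * rt 0 v))); last by rewrite mul0r addr0.
  by apply: cvgD; [exact: cvg_cst|exact: cvgM z q'].
apply: cvg_trans lim; apply: near_eq_cvg; near=> h => /=.
have h0 : h != 0 by rewrite gt_eqF//; near: h; exact: nbhs_right_gt.
by rewrite mulVKf// add0r addrC subrK.
Unshelve. all: by end_near. Qed.

Lemma critical_of_converging rt : flow_solution ends Theta Lhat rt ->
  radii_converge rt -> exists ks, critical ks.
Proof.
move=> sol [rs [adm crs]]; exists (fun v => log_curvature (rs v)).
apply: (limit_critical (log_flow_of_solution sol)) => v.
apply: cvg_comp (crs v) _.
exact: is_derive_continuous (is_derive_log_curvature (adm v)).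
Qed.

Lemma radii_exponential_convergence rt ks : critical ks ->
  flow_solution ends Theta Lhat rt ->
  exists C c, [/\ 0 < C, 0 < c & forall t v, 0 <= t ->
    `|rt t v - radii_of ks v| <= C * expR (- (c * t))].
Proof.
move=> crit sol.
have [C [c [C0 c0 h]]] := exponential_convergence crit (log_flow_of_solution sol).
exists C, c; split=> // t v t0; have [adm _] := sol t t0.
rewrite -(radii_of_log adm) !ffunE.
exact: le_trans (radius_lipschitz _ _) (h t v t0).
Qed.

Lemma converging_of_critical rt ks : critical ks ->
  flow_solution ends Theta Lhat rt -> radii_converge rt.
Proof.
move=> crit sol; have [C [c [C0 c0 h]]] := radii_exponential_convergence crit sol.
exists (radii_of ks); split=> [|v]; first exact: radii_of_admissible.
apply/cvgrPdist_lt => e e0; have [T T0 hT] := expR_small C0 c0 e0.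
exists T; split=> [|t /ltW Tt]; first exact: num_real.
rewrite distrC; apply: le_lt_trans (h t v _) (hT t Tt); exact: le_trans T0 Tt.
Qed.

End Flow.

(** * The convergence theorem *)

Theorem theorem1p2 (R : realType) (S : topologicalType) (V E : finType)
    (ends : E -> {set V}) (eta : graph_embedding R S ends)
    (Theta : E -> R) (Lhat : V -> R)
    (hS : closed_surface R S)
    (hends : two_ended ends)
    (heta : closed_2cell_embedding eta)
    (hTheta : forall e, 0 < Theta e < pi / 2)
    (hLhat : forall v, 0 < Lhat v) :
  ((forall r0 : {ffun V -> R},
      admissible_radii r0 -> flow_converges_from ends Theta Lhat r0)
   <->
   (forall X : {set V}, X != finset.set0 ->
      \sum_(v in X) Lhat v < 2 * \sum_(e in incident_edges ends X) Theta e))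
  /\
  (forall r : R -> {ffun V -> R},
     flow_solution ends Theta Lhat r -> radii_converge r ->
     exists rs : {ffun V -> R},
       unique (fun s => admissible_radii s /\
                forall v, total_geodesic_curvature ends Theta s v = Lhat v) rs
       /\
       exists C c : R, [/\ 0 < C, 0 < c &
         forall t, 0 <= t -> radii_dist (r t) rs <= C * expR (- c * t)]).
Proof.
have acuteTheta : forall e, acute (Theta e) := hTheta.
split.
  split=> [conv X X0|lt_Theta r0 adm].
    have adm0 : admissible_radii (radii_of (fun _ : V => 0 : R)).
      exact: radii_of_admissible.
    have [[rt sol rt0] cv] := conv _ adm0.
    have [ks crit] := critical_of_converging acuteTheta sol (cv rt sol rt0).
    under eq_bigr do rewrite -crit.
    by apply: sum_curv_lt => // v; rewrite crit.
  have [ks crit] := critical_exists acuteTheta hends hLhat lt_Theta.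
  split=> [|rt sol _]; last exact (converging_of_critical acuteTheta hLhat crit sol).
  have [k [k0 kd]] := log_flow_exists ends acuteTheta hLhat (fun v => log_curvature (r0 v)).
  exists (fun t => radii_of (k t)); first exact: flow_solution_of_log.
  by rewrite k0 radii_of_log.
move=> rt sol conv; have [ks crit] := critical_of_converging acuteTheta sol conv.
exists (radii_of ks); split.
  split=> [|s [adm scrit]].
    split=> [|v]; first exact: radii_of_admissible.
    by rewrite total_geodesic_curvatureE.
  rewrite -(radii_of_log adm); congr radii_of.
  apply: (critical_unique acuteTheta hLhat crit) => v.
  by rewrite -(total_geodesic_curvatureE ends acuteTheta) radii_of_log.
have [C [c [C0 c0 h]]] := radii_exponential_convergence acuteTheta hLhat crit sol.
have n0 : 0 < #|V|%:R + 1 :> R by rewrite ltr_wpDl.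
exists ((#|V|%:R + 1) * C), c; split; rewrite ?mulr_gt0// => t t0.
have e0 : 0 <= C * expR (- (c * t)) by rewrite mulr_ge0 ?expR_ge0// ltW.
have r0 : 0 <= (#|V|%:R + 1) * (C * expR (- (c * t))) by rewrite mulr_ge0// ltW.
rewrite mulNr -mulrA -[leRHS]ger0_norm// -sqrtr_sqr ler_sqrt ?sqr_ge0// exprMn.
apply: le_trans (ler_sum_card (c := (C * expR (- (c * t))) ^+ 2) _ _) _.
- exact: sqr_ge0.
- move=> v _; rewrite -real_normK ?num_real// ler_sqr ?nnegrE// h//.
by rewrite ler_wpM2r ?sqr_ge0//; have : 0 <= #|V|%:R :> R by []; nra.
Qed.
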